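(* Let $n\ge1$ and let $T$ be a good tree on the vertex set $[n+1]$. If the polynomial $P_n^{\mathcal{B}}(x_{ij})$ is a reduced form of the noncommutative monomial $m^{\mathcal{B}}[T]$, then $$P_n^{\mathcal{B}}(x_{ij})=\sum_F\beta^{\,n-|E(F)|}x^F,$$ where the sum runs over all noncrossing alternating spanning forests $F$ of $\overline{T}$ with lexicographic edge-labels, on the vertex set $[n+1]$, containing the edge $(1,n+1)$, at least one edge of the form $(i_1,j)$ with $i_1\le i$ for each right pseudo-component of $T$ on $[i,j]$, and at least one edge of the form $(i,j_1)$ with $j\le j_1$ for each left pseudo-component of $T$ on $[i,j]$; and $x^F$ is the noncommutative monomial $\prod_{l=1}^k x_{i_l,j_l}$ if $F$ contains the edges $(i_1,j_1)_1,\ldots,(i_k,j_k)_k$.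
   Context: Graphs have vertex set $[n+1]=\{1,\ldots,n+1\}$; an edge joining $i<j$ is written $(i,j)$, and $(i,j)_a$ is the edge $(i,j)$ with label $a$. A graph is noncrossing if there are no $i<j<k<l$ with $(i,k),(j,l)$ both edges; alternating if there are no $i<j<k$ with $(i,j),(j,k)$ both edges. The transitive closure $\overline{G}$ has as edges all $(i,j)$ for which there are edges $(i,i_1),(i_1,i_2),\ldots,(i_r,j)$ of $G$ with $i<i_1<\cdots<i_r<j$ (edges of $G$ included). A spanning forest of $\overline{T}$ is a forest with vertex set $[n+1]$ (isolated vertices allowed) with all edges in $\overline{T}$. A forest $H$ on $[n+1]$ with $k$ edges labeled $1,\ldots,k$ is good if: (i) if $(i,j)_a,(j,k)_b$ are edges, $i<j<k$, then $a<b$; (ii) if $(i,j)_a,(i,k)_b$ are edges with $i<j<k$, then $a>b$; (iii) if $(i,j)_a,(k,j)_b$ are edges with $i<k<j$, then $a>b$; (iv) $H$ is noncrossing. A good tree is a good forest that is a tree. Lexicographic edge-labels: $(i_1,j_1)$ is less than $(i_2,j_2)$ if $j_1>j_2$, or $j_1=j_2$ and $i_1>i_2$; a graph with $k$ edges has lexicographic edge-labels if its edges are labeled $1,\ldots,k$ increasingly in this order. Pseudo-components of a noncrossing tree $T$ (on a finite set of integers) are defined inductively. The simple path $P$ in $T$ from the smallest to the largest vertex of $T$ (from $1$ to $n+1$ when the vertex set is $[n+1]$) is a pseudo-component. The graph $T\setminus P$ (edges of $P$ removed) is an edge-disjoint union of trees $T_1,\ldots,T_k$ such that if $v$ is a vertex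 of $P$ and $v\in T_l$, then $v$ is either the minimal or the maximal vertex of $T_l$, and such that no $k-1$ trees with edge-disjoint union $T\setminus P$ satisfy these requirements. The set of pseudo-components is $ps(T)=\{P\}\cup ps(T_1)\cup\cdots\cup ps(T_k)$. A pseudo-component is on $[i,j]$, $i<j$, if it is a path with endpoints $i$ and $j$. A pseudo-component on $[i,j]$ is a left pseudo-component of $T$ if there is no edge $(s,i)\in E(T)$ with $s<i$, and a right pseudo-component of $T$ if there is no edge $(j,s)\in E(T)$ with $j<s$ (it may be both). If $G$ has labeled edges $(i_1,j_1)_1,\ldots,(i_k,j_k)_k$, then $m^{\mathcal{B}}[G]=x_{i_1j_1}\cdots x_{i_kj_k}$. The reduction rule is $x_{ij}x_{jk}\to x_{ik}x_{ij}+x_{jk}x_{ik}+\beta x_{ik}$ for $i<j<k$ ($\beta$ a central variable), applied to two adjacent variables in one monomial at a time. A reduced form is a polynomial obtained by successive applications of the rule until no further reduction is possible, where between reductions one may commute adjacent $x_{ij},x_{kl}$ with $i,j,k,l$ distinct (reduction terminates when no monomial is reducible even after such commutations). Noncommutative polynomials are considered up to these commutations. *)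

(* Defs.v *)
From HB Require Import structures.
From Stdlib Require Import Relation_Operators Relation_Definitions.
From mathcomp Require Export all_boot all_order all_algebra.
From mathcomp Require Export monalg.
From mathcomp Require Export boolp.

Set Implicit Arguments.
Unset Strict Implicit.
Unset Printing Implicit Defensive.

Import GRing.Theory.

(* The vertex v of [n+1] = {1, ..., n+1} is the ordinal of value v - 1, so 1 is
   ord0 and n+1 is ord_max; the edge joining i < j is the pair (i, j). *)
Notation vertex n := 'I_n.+1.
Notation edge n := ('I_n.+1 * 'I_n.+1)%type.

Section Graphs.

Variable n : nat.
Implicit Types (i j k l u v w : vertex n) (e f : edge n).
Implicit Types (V : {set vertex n}) (E F : {set edge n}).

Definition noncrossing E : Prop :=
  forall i j k l, i < j -> j < k -> k < l ->
    ~ ((i, k) \in E /\ (j, l) \in E).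

Definition alternating E : Prop :=
  forall i j k, i < j -> j < k -> ~ ((i, j) \in E /\ (j, k) \in E).

Definition adj E : rel (vertex n) := fun u v => ((u, v) \in E) || ((v, u) \in E).

Definition acyclic E : Prop :=
  forall c : seq (vertex n), 2 < size c -> ~ ucycle (adj E) c.

Definition graph_on V E : Prop :=
  forall e, e \in E -> [/\ e.1 < e.2, e.1 \in V & e.2 \in V].

Definition forest_on V E : Prop := graph_on V E /\ acyclic E.

Definition tree_on V E : Prop :=
  [/\ V != set0, forest_on V E
    & forall u v, u \in V -> v \in V -> connect (adj E) u v].

Definition in_closure E e : Prop :=
  exists s, path [rel u v : vertex n | (u < v) && ((u, v) \in E)] e.1 (rcons s e.2).

(* A graph with k edges labeled 1, ..., k is the list of its edges by increasing
   label; the label of e in H is (index e H).+1. *)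
Record good_forest (H : seq (edge n)) : Prop := GoodForest {
  good_uniq : uniq H;
  good_is_forest : forest_on setT [set:: H];
  good_middle : forall i j k, i < j -> j < k ->
    (i, j) \in H -> (j, k) \in H -> index (i, j) H < index (j, k) H;
  good_left : forall i j k, i < j -> j < k ->
    (i, j) \in H -> (i, k) \in H -> index (i, j) H > index (i, k) H;
  good_right : forall i j k, i < k -> k < j ->
    (i, j) \in H -> (k, j) \in H -> index (i, j) H > index (k, j) H;
  good_noncrossing : noncrossing [set:: H]
}.

Definition good_tree (H : seq (edge n)) : Prop :=
  good_forest H /\ tree_on setT [set:: H].

Definition lex_le : rel (edge n) := fun e f =>
  (f.2 < e.2) || ((e.2 == f.2) && (f.1 <= e.1)).

Definition lex_labeled E : seq (edge n) := sort lex_le (enum E).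

Definition smallest V v : Prop := v \in V /\ forall w, w \in V -> v <= w.
Definition largest V v : Prop := v \in V /\ forall w, w \in V -> w <= v.

Definition mkedge u v : edge n := if u < v then (u, v) else (v, u).

(* A path is given by its list of vertices x :: s. *)
Definition path_edges x (s : seq (vertex n)) : {set edge n} :=
  [set:: pairmap mkedge x s].

Definition min_max_path V E x (s : seq (vertex n)) : Prop :=
  [/\ path (adj E) x s, uniq (x :: s), smallest V x & largest V (last x s)].

Notation graph := ({set vertex n} * {set edge n})%type.

Implicit Type D : seq graph.

Definition splitting E x (s : seq (vertex n)) D : Prop :=
  [/\ forall W F, (W, F) \in D -> tree_on W F,
      pairwise (fun G1 G2 : graph => [disjoint G1.2 & G2.2]) D,
      \bigcup_(G <- D) G.2 = E :\: path_edges x s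
    & forall W F v, (W, F) \in D -> v \in x :: s -> v \in W ->
        smallest W v \/ largest W v].

Definition min_splitting E x s D : Prop :=
  splitting E x s D /\ forall D', (size D').+1 = size D -> ~ splitting E x s D'.

(* [pseudo_comp V E x s]: the path x :: s is a pseudo-component of the
   noncrossing tree with vertex set V and edge set E. *)
Inductive pseudo_comp V E : vertex n -> seq (vertex n) -> Prop :=
| PseudoPath x s : min_max_path V E x s -> pseudo_comp V E x s
| PseudoSub x s D W F y t :
    min_max_path V E x s -> min_splitting E x s D -> (W, F) \in D ->
    pseudo_comp W F y t -> pseudo_comp V E y t.

(* Pseudo-components are listed from their smallest vertex to their largest. *)
Definition pseudo_comp_on E i j : Prop :=
  i < j /\ exists2 s, pseudo_comp setT E i s & last i s = j.

Definition left_pseudo_comp_on E i j : Prop :=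
  pseudo_comp_on E i j /\ forall u, u < i -> (u, i) \notin E.

Definition right_pseudo_comp_on E i j : Prop :=
  pseudo_comp_on E i j /\ forall u, j < u -> (j, u) \notin E.

Record admissible (E F : {set edge n}) : Prop := Admissible {
  adm_forest : forest_on setT F;
  adm_closure : forall e, e \in F -> in_closure E e;
  adm_noncrossing : noncrossing F;
  adm_alternating : alternating F;
  adm_long_edge : (ord0, ord_max) \in F;
  adm_right : forall i j, right_pseudo_comp_on E i j ->
    exists2 i1 : vertex n, i1 <= i & (i1, j) \in F;
  adm_left : forall i j, left_pseudo_comp_on E i j ->
    exists2 j1 : vertex n, j <= j1 & (i, j1) \in F
}.

(* The free associative algebra on the variables x_ij over Z[beta]; beta is the
   indeterminate 'X of the coefficient ring. *)
Definition ncpoly := {malg {poly int}[{fmonom (edge n)}]}.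

Definition x_ e : ncpoly := (<< fmu e >>)%R.

Notation word := (seq (edge n)).
Implicit Types (m : word).

Definition ncmon m : ncpoly := (\prod_(e <- m) x_ e)%R.

Definition distinct_ends e f : bool := uniq [:: e.1; e.2; f.1; f.2].

(* The two-sided ideal generated by the commutators of the x_ij and x_kl with
   i, j, k, l distinct. *)
Inductive comm_ideal : ncpoly -> Prop :=
| CommIdeal0 : comm_ideal 0%R
| CommIdealD p q : comm_ideal p -> comm_ideal q -> comm_ideal (p + q)%R
| CommIdealM p q e f : distinct_ends e f ->
    comm_ideal (p * (x_ e * x_ f - x_ f * x_ e) * q)%R.

Definition eq_upto_comm (p q : ncpoly) : Prop := comm_ideal (p - q)%R.

Inductive swap : relation word :=
| Swap m1 m2 e f : distinct_ends e f ->
    swap (m1 ++ [:: e; f] ++ m2) (m1 ++ [:: f; e] ++ m2).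

Definition reducible m : Prop :=
  exists m1 m2 i j k, [/\ i < j, j < k
    & clos_refl_trans _ swap m (m1 ++ [:: (i, j); (j, k)] ++ m2)].

(* Reductions act on formal sums of terms, (a, m) standing for beta^a m.  Terms
   are not collected: in an element of [ncpoly] one could introduce a pair of
   cancelling monomials and then reduce only one of them. *)
Notation term := (nat * word)%type.

Definition poly_of (s : seq term) : ncpoly :=
  (\sum_(t <- s) 'X ^+ t.1 *: ncmon t.2)%R.

Inductive step : relation (seq term) :=
| StepComm s1 s2 a m m' : swap m m' ->
    step (s1 ++ [:: (a, m)] ++ s2) (s1 ++ [:: (a, m')] ++ s2)
| StepReduce s1 s2 a m1 m2 i j k : i < j -> j < k ->
    step (s1 ++ [:: (a, m1 ++ [:: (i, j); (j, k)] ++ m2)] ++ s2)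
         (s1 ++ [:: (a, m1 ++ [:: (i, k); (i, j)] ++ m2);
                    (a, m1 ++ [:: (j, k); (i, k)] ++ m2);
                    (a.+1, m1 ++ [:: (i, k)] ++ m2)] ++ s2).

Definition reduced_form m (P : ncpoly) : Prop :=
  exists s : seq term,
    [/\ clos_refl_trans _ step [:: (0, m)] s,
        forall t, t \in s -> ~ reducible t.2
      & eq_upto_comm P (poly_of s)].

End Graphs.

(* Main.v *)
(* To a word w of edges attach its open cone, the set of positive combinations
   of the vectors e_i - e_j, (i, j) in w.  A reduction splits the simplicial open
   cone of x_ij x_jk ... into the disjoint open cones of its three results,
   according to which of the coefficients of (i, j) and (j, k) is larger, or
   whether they are equal; it also preserves linear independence and the label
   conditions of good forests.  An irreducible good word is alternating and
   noncrossing, and equals its lexicographic rearrangement up to commutations.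
   As a vector lies in the open cone of at most one alternating noncrossing
   graph, F occurs in the reduced form exactly once if the sum of its vectors
   lies in the open cone of T, and not at all otherwise.  This membership means
   that F consists of edges of the closure of T whose paths in T cover all edges
   of T; the conditions on pseudo-components are a reformulation of this. *)

Require Import Defs.
From Stdlib Require Import Relation_Operators Relation_Definitions.
From mathcomp Require Import all_boot all_order all_algebra.
From mathcomp Require Import monalg boolp zify lra.

Set Implicit Arguments.
Unset Strict Implicit.
Unset Printing Implicit Defensive.

Import Order.TTheory GRing.Theory Num.Theory.

(** * Good words *)

(** The invariant is a number: for every vector v, the count of terms whose open cone contains v is
    the same after each step. For an admissible F it is evaluated at one vector only, the sum of the
    vectors of F, where it is 1 at the start; at the end it counts the terms with edge set F,
    whatever the order of the reductions. That every final term is admissible is not read off from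
    cones: the steps preserve that its edges lie in the closure of T and that their paths cover T,
    and likewise the sum of the exponent of beta and the length, which equals n. Linear independence
    makes the two compared coefficients well defined, and it takes the place of acyclicity, which is
    not a condition on pairs of letters. The recursion for pseudo-components enters through one
    consequence of the minimality of a splitting: at a vertex off the path P, all edges of the tree
    belong to the same part. Hence no edge leaves a pseudo-component from strictly between its ends,
    and at one end at least none goes beyond it. *)

Section Words.

Variable n : nat.
Implicit Types (e f g : edge n) (m w : seq (edge n)).

(* The label of e may be smaller than that of f under conditions (i)-(iv) of good
   forests. *)
Definition precedes e f : bool :=
  [&& e.1 < e.2, f.1 < f.2, e.1 != f.2 :> nat,
      (e.1 == f.1 :> nat) ==> (f.2 < e.2), (e.2 == f.2 :> nat) ==> (f.1 < e.1),
      ~~ [&& e.1 < f.1, f.1 < e.2 & e.2 < f.2] &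
      ~~ [&& f.1 < e.1, e.1 < f.2 & f.2 < e.2]].

Definition good_word w := all (fun e => e.1 < e.2) w && pairwise precedes w.

Lemma distinct_endsE e f :
  distinct_ends e f = [&& e.1 != e.2 :> nat, e.1 != f.1 :> nat,
    e.1 != f.2 :> nat, e.2 != f.1 :> nat, e.2 != f.2 :> nat & f.1 != f.2 :> nat].
Proof.
rewrite /distinct_ends /= !inE !negb_or -!val_eqE /=.
by rewrite !andbT; do !case: (_ != _).
Qed.

(** The asymmetric clauses of [precedes] all concern a shared endpoint; the remaining ones are
    symmetric. *)
Lemma precedes_swap e f : distinct_ends e f -> precedes e f -> precedes f e.
Proof. rewrite distinct_endsE /precedes; lia. Qed.

Section Triple.
Variables (i j k : vertex n) (lt_ij : i < j) (lt_jk : j < k).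

(** An edge that crosses (i, k) but neither (i, j) nor (j, k) has an endpoint at j, and there the
    label conditions exclude it. *)
Lemma precedes_shortcut_l e :
  precedes e (i, j) -> precedes e (j, k) -> precedes e (i, k).
Proof. rewrite /precedes /=; lia. Qed.

Lemma precedes_shortcut_r e :
  precedes (i, j) e -> precedes (j, k) e -> precedes (i, k) e.
Proof. rewrite /precedes /=; lia. Qed.

Lemma precedes_long_left : precedes (i, k) (i, j).
Proof. rewrite /precedes /=; lia. Qed.

Lemma precedes_right_long : precedes (j, k) (i, k).
Proof. rewrite /precedes /=; lia. Qed.

End Triple.

Lemma pairwise_mid (A : Type) (r : rel A) (m1 m m2 : seq A) :
  pairwise r (m1 ++ m ++ m2) =
  [&& allrel r m1 m, allrel r m m2, pairwise r m & pairwise r (m1 ++ m2)].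
Proof.
rewrite !pairwise_cat allrel_catr.
by do !case: (allrel _ _ _); do !case: (pairwise _ _).
Qed.

Lemma allrelr2 (A : Type) (r : rel A) (s : seq A) a b :
  allrel r s [:: a; b] = all (fun x => r x a && r x b) s.
Proof. by rewrite /allrel; apply: eq_all => x /=; rewrite andbT. Qed.

Lemma allrelr1 (A : Type) (r : rel A) (s : seq A) a :
  allrel r s [:: a] = all (fun x => r x a) s.
Proof. by rewrite /allrel; apply: eq_all => x /=; rewrite andbT. Qed.

Lemma allrell2 (A : Type) (r : rel A) (s : seq A) a b :
  allrel r [:: a; b] s = all (fun x => r a x && r b x) s.
Proof. by rewrite allrel_consl allrel1l -all_predI; apply: eq_all. Qed.

Lemma good_word_uniq w : good_word w -> uniq w.
Proof.
case/andP=> _ Hw; rewrite uniq_pairwise; apply: sub_pairwise Hw => e f.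
rewrite /precedes => /andP[? Hef]; apply/eqP => eq_ef; move: Hef.
by rewrite eq_ef eqxx; lia.
Qed.

Lemma swap_perm w w' : swap w w' -> perm_eq w w'.
Proof.
case=> m1 m2 e f _; rewrite perm_cat2l perm_cat2r.
by rewrite -[[:: e; f]]/([:: e] ++ [:: f]) perm_catC.
Qed.

Lemma swap_good w w' : swap w w' -> good_word w -> good_word w'.
Proof.
move=> sw; rewrite /good_word (perm_all _ (swap_perm sw)); case: sw => m1 m2 e f d.
rewrite !pairwise_mid !allrelr2 !allrell2 /= !andbT.
case/and5P=> -> H1 H2 pef -> /=; rewrite andbT (precedes_swap d pef) andbT.
by apply/andP; split; [move: H1 | move: H2]; apply: sub_all => x; rewrite andbC.
Qed.

Section Reduction.
Variables (i j k : vertex n) (lt_ij : i < j) (lt_jk : j < k).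
Variables (m1 m2 : seq (edge n)).
Let w := m1 ++ [:: (i, j); (j, k)] ++ m2.
Hypothesis good_w : good_word w.

Let good_wE :
  [/\ all (fun e => e.1 < e.2) (m1 ++ m2), pairwise precedes (m1 ++ m2),
      all (fun e => precedes e (i, j) && precedes e (j, k)) m1 &
      all (fun e => precedes (i, j) e && precedes (j, k) e) m2].
Proof.
move: good_w; rewrite /good_word /w pairwise_mid allrelr2 allrell2 !all_cat.
by case/and5P=> /and3P[-> _ ->] -> -> _ ->.
Qed.

Lemma good_reduce_left : good_word (m1 ++ [:: (i, k); (i, j)] ++ m2).
Proof.
case: good_wE; rewrite /good_word pairwise_mid allrelr2 allrell2 !all_cat /=.
case/andP=> -> -> -> H1 H2; rewrite lt_ij (ltn_trans lt_ij lt_jk).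
rewrite precedes_long_left //= !andbT; apply/andP; split.
  by apply: sub_all H1 => e /andP[He1 He2]; rewrite He1 (precedes_shortcut_l _ _ He1 He2).
by apply: sub_all H2 => e /andP[He1 He2]; rewrite He1 (precedes_shortcut_r _ _ He1 He2).
Qed.

Lemma good_reduce_right : good_word (m1 ++ [:: (j, k); (i, k)] ++ m2).
Proof.
case: good_wE; rewrite /good_word pairwise_mid allrelr2 allrell2 !all_cat /=.
case/andP=> -> -> -> H1 H2; rewrite lt_jk (ltn_trans lt_ij lt_jk).
rewrite precedes_right_long //= !andbT; apply/andP; split.
  by apply: sub_all H1 => e /andP[He1 He2]; rewrite He2 (precedes_shortcut_l _ _ He1 He2).
by apply: sub_all H2 => e /andP[He1 He2]; rewrite He2 (precedes_shortcut_r _ _ He1 He2).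
Qed.

Lemma good_reduce_merge : good_word (m1 ++ [:: (i, k)] ++ m2).
Proof.
case: good_wE; rewrite /good_word pairwise_mid allrelr1 allrel1l !all_cat /=.
case/andP=> -> -> -> H1 H2; rewrite (ltn_trans lt_ij lt_jk) !andbT /=.
apply/andP; split.
  by apply: sub_all H1 => e /andP[He1 He2]; rewrite (precedes_shortcut_l _ _ He1 He2).
by apply: sub_all H2 => e /andP[He1 He2]; rewrite (precedes_shortcut_r _ _ He1 He2).
Qed.

End Reduction.

Local Notation swaps := (clos_refl_trans _ (@swap n)).

Lemma swaps_ctx m1 m2 w w' : swaps w w' -> swaps (m1 ++ w ++ m2) (m1 ++ w' ++ m2).
Proof.
elim=> [_ _ [a b e f d]|x|x y z _ Hxy _ Hyz]; last exact: rt_trans Hxy Hyz.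
  by apply: rt_step; have := Swap (m1 ++ a) (b ++ m2) d; rewrite -!catA.
exact: rt_refl.
Qed.

Lemma swaps_perm w w' : swaps w w' -> perm_eq w w'.
Proof.
elim=> [x y /swap_perm //|x|x y z _ Hxy _ Hyz]; first exact: perm_refl.
exact: perm_trans Hxy Hyz.
Qed.

Lemma swaps_cons e w w' : swaps w w' -> swaps (e :: w) (e :: w').
Proof. by move=> /(swaps_ctx [:: e] [::]); rewrite !cats0. Qed.

Lemma swaps_move e w : all (distinct_ends e) w -> swaps (e :: w) (rcons w e).
Proof.
elim: w => [|f w IHw] /=; first by move=> _; apply: rt_refl.
case/andP=> def /IHw{}IHw; apply: (rt_trans _ _ _ (f :: e :: w)); last exact: swaps_cons.
exact/rt_step/(Swap [::] w def).
Qed.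

(** Only an [a]-letter standing before a letter of the other kind has to be passed; inside each
    class the order is kept. *)
Lemma swaps_partition (a : pred (edge n)) w :
  pairwise (fun e f => a e ==> ~~ a f ==> distinct_ends e f) w ->
  swaps w ([seq e <- w | ~~ a e] ++ [seq e <- w | a e]).
Proof.
elim: w => [|e w IHw] /=; first by move=> _; apply: rt_refl.
case/andP=> He /IHw{}IHw; case ae: (a e) => /=; last exact: swaps_cons.
apply: rt_trans (swaps_cons e IHw) _.
have /swaps_move : all (distinct_ends e) [seq x <- w | ~~ a x].
  rewrite all_filter; apply: sub_all He => f; by rewrite ae.
by move=> /(swaps_ctx [::] [seq x <- w | a x]); rewrite cat_rcons.
Qed.

End Words.

(** * Words that no commutation makes reducible *)

Section Irreducible.

Variable n : nat.
Implicit Types (e f g : edge n) (m w : seq (edge n)).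
Local Notation swaps := (clos_refl_trans _ (@swap n)).

Lemma swaps_move_left f w :
  all (fun e => distinct_ends e f) w -> swaps (rcons w f) (f :: w).
Proof.
elim: w => [|e w IHw] /=; first by move=> _; apply: rt_refl.
case/andP=> def /IHw{}IHw; apply: (rt_trans _ _ _ (e :: f :: w)).
  exact: swaps_cons.
exact/rt_step/(Swap [::] w def).
Qed.

Lemma pairwiseN_split (A : Type) (r : rel A) (s : seq A) :
  ~~ pairwise r s ->
  exists s1 x s2 y s3, s = s1 ++ x :: s2 ++ y :: s3 /\ ~~ r x y.
Proof.
elim: s => [|z s IHs] //=; rewrite negb_and => /orP[|/IHs]; last first.
  by case=> s1 [x [s2 [y [s3 [-> nr]]]]]; exists (z :: s1), x, s2, y, s3.
rewrite -has_predC => Hs; have [a [s1 [s2 [-> ra]]]] : exists a s1 s2,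
    s = s1 ++ a :: s2 /\ ~~ r z a.
  elim: s Hs {IHs} => //= b s IHs; case rb: (r z b) => /=; last first.
    by move=> _; exists b, [::], s; rewrite rb.
  by move/IHs=> [a [s1 [s2 [-> ra]]]]; exists a, (b :: s1), s2.
by exists [::], z, s1, a, s2.
Qed.

(** With e = (i, j) and f = (i, b), condition (ii) gives b < j. The delicate case is a right end b
    shared with g = (a, b): condition (iii) gives a < i, and then g crosses e. *)
Lemma precedes_fan (e f g : edge n) :
  precedes e f -> precedes f g -> f.2 != g.1 :> nat -> precedes e g ->
  (f.1 == e.1 :> nat) ==> (g.1 != e.1 :> nat) ==> distinct_ends f g.
Proof.
rewrite distinct_endsE /precedes.
case: e f g => [[e1 ?] [e2 ?]] [[f1 ?] [f2 ?]] [[g1 ?] [g2 ?]] /=.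
move=> ef fg fg' eg; apply/implyP => /eqP E; subst f1; apply/implyP=> E.
by lia.
Qed.

(* Take (i, j) and (j, k) with no closer chain between them.  The edges between
   them that do not commute with (i, j) are of the form (i, b); these can be
   moved to the right of everything else, including (j, k). *)
Lemma chain_reducible w m m1 m2 (i j k : vertex n) :
  good_word w -> w = m1 ++ (i, j) :: m ++ (j, k) :: m2 -> reducible w.
Proof.
move: {2}(size m).+1 (ltnSn (size m)) => N.
elim: N m m1 m2 i j k => // N IHN m m1 m2 i j k; rewrite ltnS => sz_m gw def_w.
(* An edge of [m] at j forms a chain with (i, j) or with (j, k), and the gap of that chain is
   shorter. *)
have [/hasP[[x1 x2] xm]|no_j] :=
    boolP (has (fun x : edge n => (x.1 == j :> nat) || (x.2 == j :> nat)) m).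
  case/splitPr: xm sz_m def_w => a b; rewrite size_cat /= => sz_m def_w.
  case/orP=> /eqP/val_inj ?; [subst x1 | subst x2].
    apply: (IHN a m1 (b ++ (j, k) :: m2) i j x2) => //; first by lia.
    by rewrite def_w -!catA.
  apply: (IHN b (m1 ++ (i, j) :: a) m2 x1 j k) => //; first by lia.
  by rewrite def_w -!catA.
have [chain_free|] :=
    boolP (pairwise (fun x y : edge n => x.2 != y.1 :> nat) m); last first.
  case/pairwiseN_split=> a [[x1 x2] [b [[y1 y2] [c [def_m]]]]].
  rewrite negbK /= => /eqP/val_inj ?; subst y1.
  apply: (IHN b (m1 ++ (i, j) :: a) (c ++ (j, k) :: m2) x1 x2 y2) => //.
    by move: sz_m; rewrite def_m size_cat /= size_cat /=; lia.
  by rewrite def_w def_m -!catA /= -catA.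
have : pairwise (@precedes n) ((i, j) :: m ++ [:: (j, k)]).
  have /andP[_] := gw; rewrite def_w -(cat_rcons (j, k)) -cat_cons pairwise_mid.
  by rewrite -cats1 => /and4P[].
rewrite /= pairwise_cat all_cat /= allrelr1 !andbT.
case/and3P=> /andP[em ef] mf pm.
pose a := fun e : edge n => e.1 == i :> nat.
have sw_m : swaps m ([seq e <- m | ~~ a e] ++ [seq e <- m | a e]).
  apply: swaps_partition; move: em chain_free pm {IHN sz_m mf no_j def_w}.
  elim: m => //= x m IHm /andP[ex em] /andP[xm mm] /andP[pxm pmm].
  rewrite IHm // andbT; apply/allP => y ym.
  have := allP em _ ym; have := allP xm _ ym; have := allP pxm _ ym.
  exact: precedes_fan.
(* A letter after (i, j) cannot end at i; as it does not start at i nor touch j, it commutes with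
   (i, j). *)
have sw_e : swaps ((i, j) :: [seq e <- m | ~~ a e])
                  (rcons [seq e <- m | ~~ a e] (i, j)).
  apply: swaps_move; rewrite all_filter; apply/allP => x xm /=.
  have := allP em _ xm; move/hasPn: no_j => /(_ _ xm).
  rewrite distinct_endsE /a /precedes /=; lia.
(* A letter (i, b) after (i, j) has b < j, so it commutes with (j, k). *)
have sw_f : swaps (rcons [seq e <- m | a e] (j, k)) ((j, k) :: [seq e <- m | a e]).
  apply: swaps_move_left; rewrite all_filter; apply/allP => x xm /=.
  have := allP em _ xm; have := allP mf _ xm; move/hasPn: no_j => /(_ _ xm).
  move: ef; rewrite distinct_endsE /a /precedes /=; lia.
exists (m1 ++ [seq e <- m | ~~ a e]), ([seq e <- m | a e] ++ m2), i, j, k.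
split; [by move: ef; rewrite /precedes /=; lia.. |].
rewrite def_w -!catA; apply: (rt_trans _ _ _
  (m1 ++ (i, j) :: ([seq e <- m | ~~ a e] ++ [seq e <- m | a e]) ++ (j, k) :: m2)).
  rewrite -!(cat_rcons (i, j)); exact: swaps_ctx sw_m.
rewrite -cat_rcons -!catA -(cat_rcons (j, k)).
apply: (rt_trans _ _ _
  (m1 ++ (i, j) :: [seq e <- m | ~~ a e] ++ (j, k) :: [seq e <- m | a e] ++ m2)).
  have := swaps_ctx (rcons m1 (i, j) ++ [seq e <- m | ~~ a e]) m2 sw_f.
  by rewrite -!catA !cat_rcons.
have := swaps_ctx m1 ((j, k) :: [seq e <- m | a e] ++ m2) sw_e.
by rewrite !cat_rcons.
Qed.

Lemma pairwise_mem (A : eqType) (r : rel A) (s : seq A) x y :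
  pairwise r s -> x \in s -> y \in s -> x != y -> r x y || r y x.
Proof.
elim: s => //= z s IHs /andP[rz rs]; rewrite !inE.
case/predU1P=> [->|xs] /predU1P[->|ys]; rewrite ?eqxx // => neq_xy.
- by rewrite (allP rz).
- by rewrite (allP rz _ xs) orbT.
- exact: IHs.
Qed.

Lemma good_word_oriented w : good_word w -> graph_on setT [set:: w].
Proof. by case/andP=> /allP Hw _ e; rewrite !inE => /Hw. Qed.

Lemma good_word_noncrossing w : good_word w -> noncrossing [set:: w].
Proof.
case/andP=> _ Hw i j k l ij jk kl; rewrite !inE => -[ik jl].
have := pairwise_mem Hw ik jl; rewrite xpair_eqE -!val_eqE /= /precedes /=; lia.
Qed.

Lemma irreducible_alternating w :
  good_word w -> ~ reducible w -> alternating [set:: w].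
Proof.
move=> gw irr i j k ij jk; rewrite !inE => -[w_ij w_jk].
case/splitPr: w_ij gw irr w_jk => a b gw irr; rewrite mem_cat inE xpair_eqE.
rewrite -!val_eqE /= (gtn_eqF ij) /= => /orP[w_jk|w_jk].
  case/andP: gw => _; rewrite pairwise_cat => /and3P[/allrelP H _ _].
  by have := H (j, k) (i, j) w_jk; rewrite inE eqxx /precedes /=; lia.
by case/splitPr: w_jk gw irr => c d gw; apply; apply: chain_reducible gw erefl.
Qed.

Lemma lex_le_total : total (@lex_le n).
Proof. by move=> e f; rewrite /lex_le -!val_eqE /=; lia. Qed.

Lemma lex_le_trans : transitive (@lex_le n).
Proof. by move=> e f g; rewrite /lex_le -!val_eqE /=; lia. Qed.

Lemma lex_le_anti : antisymmetric (@lex_le n).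
Proof.
move=> [e1 e2] [f1 f2]; rewrite /lex_le -!val_eqE /= => H.
by congr (_, _); apply/val_inj => /=; lia.
Qed.

(** Conditions (ii) and (iii) order edges with a common left or right end exactly as the
    lexicographic order does; the hypothesis and (i) exclude that a left end is also a right end. *)
Lemma precedes_lex_or_commute (e f : edge n) :
  precedes e f -> e.2 != f.1 :> nat -> lex_le e f || distinct_ends e f.
Proof.
rewrite distinct_endsE /precedes /lex_le -!val_eqE /=.
by case: e f => [[e1 ?] [e2 ?]] [[f1 ?] [f2 ?]] /=; lia.
Qed.

Lemma swaps_sort w :
  pairwise (fun e f => lex_le e f || distinct_ends e f) w ->
  swaps w (sort (@lex_le n) w).
Proof.
have sorted_sort v : sorted (@lex_le n) (sort (@lex_le n) v).
  exact: sort_sorted lex_le_total _.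
elim: w => [|e w IHw] /=; first by move=> _; apply: rt_refl.
case/andP=> He /IHw{}IHw; apply: rt_trans (swaps_cons e IHw) _.
have {He}: all (fun f => lex_le e f || distinct_ends e f) (sort (@lex_le n) w).
  by rewrite all_sort.
(* Insertion sort: e has to pass only letters that should precede it, and with these it commutes. *)
suff ins v : sorted (@lex_le n) v ->
    all (fun f => lex_le e f || distinct_ends e f) v ->
    exists2 v', sorted (@lex_le n) v' & swaps (e :: v) v'.
  move=> He; have [v' sv' sw] := ins _ (sorted_sort w) He.
  suff -> : sort (@lex_le n) (e :: w) = v' by [].
  apply: (sorted_eq lex_le_trans lex_le_anti) => //.
  apply: perm_trans (swaps_perm sw).
  by rewrite perm_sort perm_cons perm_sym perm_sort.
elim: v => [|f v IHv]; first by exists [:: e] => //; apply: rt_refl.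
move=> sfv /= /andP[Hf Hv]; have [ef|nef] := boolP (lex_le e f).
  by exists [:: e, f & v]; rewrite /= ?ef //; apply: rt_refl.
have [v' sv' sw] := IHv (path_sorted sfv) Hv.
exists (f :: v'); last first.
  apply: (rt_trans _ _ _ (f :: e :: v)); last exact: swaps_cons.
  by rewrite (negPf nef) in Hf; exact/rt_step/(Swap [::] v Hf).
rewrite /= (path_sortedE lex_le_trans) sv' andbT.
rewrite -(perm_all _ (swaps_perm sw)) /=.
have := lex_le_total e f; rewrite (negPf nef) /= => -> /=.
by move: sfv; rewrite /= (path_sortedE lex_le_trans) => /andP[].
Qed.

Lemma swaps_lex_labeled w :
  good_word w -> alternating [set:: w] -> swaps w (lex_labeled [set:: w]).
Proof.
move=> gw alt; have -> : lex_labeled [set:: w] = sort (@lex_le n) w.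
  apply/(perm_sortP lex_le_total lex_le_trans lex_le_anti).
  apply: uniq_perm; rewrite ?enum_uniq ?good_word_uniq // => e.
  by rewrite mem_enum inE.
apply: swaps_sort; case/andP: gw => /allP ow pw.
apply: (@sub_in_pairwise _ (mem w) (@precedes n)) pw; last exact/allP.
move=> e f ew fw pef; apply: precedes_lex_or_commute => //; apply/eqP => ef.
apply: (alt e.1 e.2 f.2); [|rewrite ef|]; rewrite ?ow //.
by rewrite !inE {2}(val_inj ef) -!surjective_pairing.
Qed.
End Irreducible.

(** * Open cones *)

Section Rearrange.

Variables (R : pzRingType) (V : lmodType R) (a b u : V) (x y : R).

(** Here a and b stand for the vectors of (i, j) and (j, k), so that a + b is the vector of (i, k);
    the identities express the three results of a reduction in terms of a and b. *)
Lemma scale_both : (x *: a + x *: b + u = x *: (a + b) + u)%R.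
Proof. by rewrite scalerDr. Qed.

Lemma scale_left :
  (x *: (a + b) + (y *: a + u) = (x + y) *: a + x *: b + u)%R.
Proof. by rewrite scalerDl scalerDr -!addrA; congr (_ + _)%R; rewrite addrCA. Qed.

Lemma scale_right :
  (y *: b + (x *: (a + b) + u) = x *: a + (y + x) *: b + u)%R.
Proof. by rewrite scalerDl scalerDr -!addrA; apply: addrCA. Qed.

Lemma scale_sub (x' y' : R) (u' : V) :
  ((x - x') *: a + (y - y') *: b + (u - u') =
   x *: a + y *: b + u - (x' *: a + y' *: b + u'))%R.
Proof. by rewrite !scalerBl !opprD [RHS]addrACA; congr (_ + _)%R; apply: addrACA. Qed.

End Rearrange.

Section Cones.

Variable n : nat.
Implicit Types (e f a b : edge n) (m w : seq (edge n)) (c : edge n -> rat).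
Implicit Types (v : 'rV[rat]_n.+1).

Definition root_vec e : 'rV[rat]_n.+1 := (delta_mx 0 e.1 - delta_mx 0 e.2)%R.

(** Coefficients are indexed by edges, not by positions, so reordering a word leaves them alone;
    repeated letters would share one, hence the [uniq] hypotheses below. *)
Definition flow c w : 'rV[rat]_n.+1 := (\sum_(e <- w) c e *: root_vec e)%R.

Definition open_cone w v : Prop :=
  exists2 c, forall e, e \in w -> (0 < c e)%R & flow c w = v.

Definition indep w : Prop :=
  forall c, flow c w = 0%R -> forall e, e \in w -> c e = 0%R.

Lemma root_vec_trans i j k :
  root_vec (i, k) = (root_vec (i, j) + root_vec (j, k))%R.
Proof. by rewrite /root_vec /= addrA subrK. Qed.

Lemma flow_perm c w w' : perm_eq w w' -> flow c w = flow c w'.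
Proof. by move=> ww'; apply: perm_big. Qed.

Lemma open_cone_perm w w' v : perm_eq w w' -> open_cone w v -> open_cone w' v.
Proof.
move=> ww' [c c_gt0 <-]; exists c; last by rewrite (flow_perm _ ww').
by move=> e; rewrite -(perm_mem ww'); apply: c_gt0.
Qed.

Lemma indep_perm w w' : perm_eq w w' -> indep w -> indep w'.
Proof.
move=> ww' iw c; rewrite -(flow_perm _ ww') => /iw c0 e.
by rewrite -(perm_mem ww'); apply: c0.
Qed.

Lemma eq_flow c c' w : {in w, c =1 c'} -> flow c w = flow c' w.
Proof. by move=> cc'; apply: eq_big_seq => e /cc' ->. Qed.

Lemma flow_cons c e w : flow c (e :: w) = (c e *: root_vec e + flow c w)%R.
Proof. exact: big_cons. Qed.

Lemma extend_coef c e (x : rat) w :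
  e \notin w -> exists2 c', c' e = x & {in w, c' =1 c}.
Proof.
move=> ew; exists (fun f => if f == e then x else c f); first by rewrite eqxx.
by move=> f fw; case: eqP => // fe; rewrite -fe fw in ew.
Qed.

Lemma open_cone1 e w v : e \notin w -> open_cone (e :: w) v <->
  exists c (x : rat), [/\ (0 < x)%R, forall f, f \in w -> (0 < c f)%R
    & (x *: root_vec e + flow c w)%R = v].
Proof.
move=> ew; split=> [[c c_gt0]|[c [x [x_gt0 c_gt0 <-]]]].
  rewrite flow_cons => <-; exists c, (c e); split=> //; first by rewrite c_gt0 ?mem_head.
  by move=> f fw; rewrite c_gt0 ?inE ?fw ?orbT.
have [c' c'e c'w] := extend_coef c x ew; exists c'; last first.
  by rewrite flow_cons c'e (eq_flow c'w).
by move=> f; rewrite inE => /predU1P[->|fw]; rewrite ?c'e ?c'w ?c_gt0.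
Qed.

Lemma open_cone2 a b w v : uniq [:: a, b & w] -> open_cone [:: a, b & w] v <->
  exists c (x y : rat), [/\ (0 < x)%R, (0 < y)%R,
    forall f, f \in w -> (0 < c f)%R
    & (x *: root_vec a + y *: root_vec b + flow c w)%R = v].
Proof.
rewrite cons_uniq => /andP[aw]; rewrite cons_uniq => /andP[bw _].
rewrite (open_cone1 _ aw); split=> [[c [x [x_gt0 c_gt0 <-]]]|].
  exists c, x, (c b); rewrite flow_cons addrA; split=> //.
    by rewrite c_gt0 ?mem_head.
  by move=> f fw; rewrite c_gt0 ?inE ?fw ?orbT.
case=> c [x [y [x_gt0 y_gt0 c_gt0 <-]]].
have [c' c'b c'w] := extend_coef c y bw; exists c', x; split=> //.
  by move=> f; rewrite inE => /predU1P[->|fw]; rewrite ?c'b ?c'w ?c_gt0.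
by rewrite flow_cons c'b (eq_flow c'w) addrA.
Qed.

Lemma indep2 a b w c (x y : rat) : uniq [:: a, b & w] -> indep [:: a, b & w] ->
  (x *: root_vec a + y *: root_vec b + flow c w = 0)%R ->
  [/\ x = 0%R, y = 0%R & forall f, f \in w -> c f = 0%R].
Proof.
rewrite cons_uniq => /andP[aw]; rewrite cons_uniq => /andP[bw _] iw.
have [c1 c1b c1w] := extend_coef c y bw.
have [c2 c2a c2w] := extend_coef c1 x aw.
rewrite -addrA -{1}c1b -(eq_flow c1w) -flow_cons -(eq_flow c2w) -{1}c2a -flow_cons.
move/iw => c2_0; split; first by rewrite -c2a c2_0 ?mem_head.
  by rewrite -c1b -c2w ?mem_head // c2_0 // inE mem_head orbT.
by move=> f fw; rewrite -c1w // -c2w ?c2_0 ?inE ?fw ?orbT.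
Qed.

Lemma flowD c c' w : flow (fun e => c e + c' e)%R w = (flow c w + flow c' w)%R.
Proof. by rewrite /flow -big_split; apply: eq_bigr => e _; rewrite scalerDl. Qed.

Lemma flowN c w : flow (fun e => - c e)%R w = (- flow c w)%R.
Proof. by rewrite /flow -sumrN; apply: eq_bigr => e _; rewrite scaleNr. Qed.

Lemma indep_inj w c c' : indep w -> flow c w = flow c' w -> {in w, c =1 c'}.
Proof.
move=> iw cc' e ew; apply/eqP; rewrite -subr_eq0; apply/eqP.
by apply: (iw (fun e => c e + - c' e)%R) => //; rewrite flowD flowN cc' subrr.
Qed.

Section Reduction.
Variables (i j k : vertex n) (w : seq (edge n)).
Hypothesis uniq_w : uniq [:: (i, j), (j, k) & w].
Hypothesis uniq_left : uniq [:: (i, k), (i, j) & w].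
Hypothesis uniq_right : uniq [:: (j, k), (i, k) & w].
Hypothesis indep_w : indep [:: (i, j), (j, k) & w].

Let rv := root_vec_trans i j k.

Lemma indep_reduce_left : indep [:: (i, k), (i, j) & w].
Proof.
move=> c; rewrite !flow_cons => c0.
have [||z0 t0 w0] := @indep2 (i, j) (j, k) w c (c (i, k) + c (i, j))%R (c (i, k)) uniq_w.
- exact: indep_w.
- by rewrite -[RHS]c0 rv scale_left.
by move: z0; rewrite t0 add0r => z0 e; rewrite !inE => /or3P[/eqP->|/eqP->|/w0].
Qed.

Lemma indep_reduce_right : indep [:: (j, k), (i, k) & w].
Proof.
move=> c; rewrite !flow_cons => c0.
have [||z0 t0 w0] := @indep2 (i, j) (j, k) w c (c (i, k)) (c (j, k) + c (i, k))%R uniq_w.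
- exact: indep_w.
- by rewrite -[RHS]c0 rv scale_right.
by move: t0; rewrite z0 addr0 => t0 e; rewrite !inE => /or3P[/eqP->|/eqP->|/w0].
Qed.

Lemma indep_reduce_merge : indep ((i, k) :: w).
Proof.
move=> c; rewrite flow_cons => c0.
have [||z0 _ w0] := @indep2 (i, j) (j, k) w c (c (i, k)) (c (i, k)) uniq_w.
- exact: indep_w.
- by rewrite scale_both -rv.
by move=> e; rewrite inE => /predU1P[->|/w0].
Qed.

(** Truth values are added as numbers so that the identity can be summed over terms in
    [cone_count]. *)
Lemma open_cone_reduce v :
  `[< open_cone [:: (i, j), (j, k) & w] v >] =
  (`[< open_cone [:: (i, k), (i, j) & w] v >] +
   `[< open_cone [:: (j, k), (i, k) & w] v >] +
   `[< open_cone ((i, k) :: w) v >])%N :> nat.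
Proof.
pose rep c (x y : rat) := [/\ (0 < x)%R, (0 < y)%R,
    forall f, f \in w -> (0 < c f)%R
    & (x *: root_vec (i, j) + y *: root_vec (j, k) + flow c w)%R = v].
have repP := @open_cone2 _ _ _ v uniq_w.
have leftP : open_cone [:: (i, k), (i, j) & w] v <->
    exists c x y, rep c x y /\ (y < x)%R.
  rewrite open_cone2 //; split=> [[c [z [t [z0 t0 c0 E]]]]|].
    exists c, (z + t)%R, z; split; last by lra.
    by split=> //; [lra | rewrite -scale_left -rv addrA].
  case=> c [x [y [[x0 y0 c0 E] lt_yx]]]; exists c, y, (x - y)%R.
  split=> //; first by lra.
  by rewrite rv -addrA scale_left [(y + _)%R]addrC subrK.
have rightP : open_cone [:: (j, k), (i, k) & w] v <->
    exists c x y, rep c x y /\ (x < y)%R.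
  rewrite open_cone2 //; split=> [[c [t [z [t0 z0 c0 E]]]]|].
    exists c, z, (t + z)%R; split; last by lra.
    by split=> //; [lra | rewrite -scale_right -rv addrA].
  case=> c [x [y [[x0 y0 c0 E] lt_xy]]]; exists c, (y - x)%R, x.
  split=> //; first by lra.
  by rewrite rv -addrA scale_right subrK.
have mergeP : open_cone ((i, k) :: w) v <-> exists c x y, rep c x y /\ x = y.
  have ikw : (i, k) \notin w by move: uniq_right => /= /and3P[].
  rewrite open_cone1 //; split=> [[c [z [z0 c0 E]]]|].
    by exists c, z, z; split=> //; split=> //; rewrite scale_both -rv.
  case=> c [x [y [[x0 y0 c0 E] eq_xy]]]; exists c, x; split=> //.
  by move: E; rewrite -eq_xy scale_both -rv.
(* By independence x and y depend on v alone, so the cases y < x, x < y and x = y exclude each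
   other. *)
have rep_inj c x y c' x' y' : rep c x y -> rep c' x' y' -> x = x' /\ y = y'.
  move=> [_ _ _ E1] [_ _ _ E2].
  have [||x0 y0 _] := @indep2 (i, j) (j, k) w
    (fun e => c e + - c' e)%R (x - x')%R (y - y')%R uniq_w.
  - exact: indep_w.
  - by rewrite flowD flowN scale_sub E1 E2 subrr.
  by split; lra.
have [[c [x [y r]]]|no_rep] := pselect (exists c x y, rep c x y); last first.
  rewrite !asboolF //.
  - by move/mergeP=> [c [x [y [r _]]]]; apply: no_rep; exists c, x, y.
  - by move/rightP=> [c [x [y [r _]]]]; apply: no_rep; exists c, x, y.
  - by move/leftP=> [c [x [y [r _]]]]; apply: no_rep; exists c, x, y.
  - by move/repP=> [c [x [y r]]]; apply: no_rep; exists c, x, y.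
rewrite [`[< open_cone [:: (i, j), _ & _] _ >]]asboolT; last first.
  by apply/repP; exists c, x, y.
have -> : `[< open_cone [:: (i, k), (i, j) & w] v >] = (y < x)%R.
  apply: (asbool_equiv_eqP idP); rewrite leftP; split; last by exists c, x, y.
  by case=> c' [x' [y' [r' lt]]]; have [-> ->] := rep_inj _ _ _ _ _ _ r r'.
have -> : `[< open_cone [:: (j, k), (i, k) & w] v >] = (x < y)%R.
  apply: (asbool_equiv_eqP idP); rewrite rightP; split; last by exists c, x, y.
  by case=> c' [x' [y' [r' lt]]]; have [-> ->] := rep_inj _ _ _ _ _ _ r r'.
have -> : `[< open_cone ((i, k) :: w) v >] = (x == y).
  apply: (asbool_equiv_eqP eqP); rewrite mergeP; split; last by exists c, x, y.
  by case=> c' [x' [y' [r' lt]]]; have [-> ->] := rep_inj _ _ _ _ _ _ r r'.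
by case: ltgtP.
Qed.

End Reduction.
End Cones.

(** * Alternating noncrossing graphs are determined by their net flow *)

Section Alternating.

Variable n : nat.
Implicit Types (E F : {set edge n}) (c : edge n -> rat) (p q u : vertex n).

(* The net flow out of u when every edge e of F carries c e. *)
Definition excess F c u : rat :=
  (\sum_(e in F) c e * ((e.1 == u)%:R - (e.2 == u)%:R))%R.

Lemma flow_coord c w u :
  uniq w -> flow c w ord0 u = excess [set:: w] c u.
Proof.
move=> uw; rewrite /flow summxE big_uniq //; apply: eq_big => [e|e _].
  by rewrite inE.
by rewrite !mxE !eqxx /= ![u == _]eq_sym.
Qed.

Section Weighted.
Variables (F : {set edge n}) (c : edge n -> rat).
Hypotheses (F_alt : alternating F) (F_or : graph_on setT F).
Hypothesis (c_gt0 : forall e, e \in F -> (0 < c e)%R).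

(** In an alternating graph no vertex is both a left and a right end, so nothing cancels in
    [excess]. *)
Let out_term p q e : (p, q) \in F -> e \in F -> (e.2 == p) = false.
Proof.
move=> pq eF; apply/eqP => ep; have [e12 _ _] := F_or eF; have [/= lt_pq _ _] := F_or pq.
case: e ep e12 eF => e1 e2 /= ->{e2} e1p e1F; exact: (F_alt e1p lt_pq).
Qed.

Let in_term p q e : (p, q) \in F -> e \in F -> (e.1 == q) = false.
Proof.
move=> pq eF; apply/eqP => eq; have [e12 _ _] := F_or eF; have [/= lt_pq _ _] := F_or pq.
case: e eq e12 eF => e1 e2 /= ->{e1} qe2 e2F; exact: (F_alt lt_pq qe2).
Qed.

Lemma excess_source p q : (p, q) \in F ->
  excess F c p = (\sum_(e in F | e.1 == p) c e)%R.
Proof.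
move=> pq; rewrite big_mkcondr; apply: eq_bigr => e eF.
by rewrite (out_term pq eF) subr0; case: eqP; rewrite ?mulr1 ?mulr0.
Qed.

Lemma excess_sink p q : (p, q) \in F ->
  excess F c q = (- \sum_(e in F | e.2 == q) c e)%R.
Proof.
move=> pq; rewrite big_mkcondr -sumrN; apply: eq_bigr => e eF.
by rewrite (in_term pq eF) sub0r; case: eqP; rewrite ?mulrN ?mulr1 ?mulr0 ?oppr0.
Qed.

Lemma excess_source_ge p q : (p, q) \in F -> (c (p, q) <= excess F c p)%R.
Proof.
move=> pq; rewrite (excess_source pq) (bigD1 (p, q)) /=; last by rewrite pq eqxx.
by rewrite lerDl sumr_ge0 // => e /andP[/andP[eF _] _]; apply/ltW/c_gt0.
Qed.

Lemma excess_sink_le p q : (p, q) \in F -> (c (p, q) <= - excess F c q)%R.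
Proof.
move=> pq; rewrite (excess_sink pq) opprK (bigD1 (p, q)) /=; last by rewrite pq eqxx.
by rewrite lerDl sumr_ge0 // => e /andP[/andP[eF _] _]; apply/ltW/c_gt0.
Qed.

(** The left ends, and below the right ends, are recognized from the excess alone; two graphs with
    equal excess therefore share them. *)
Lemma excess_gt0P p : reflect (exists q, (p, q) \in F) (0 < excess F c p)%R.
Proof.
apply: (iffP idP) => [|[q pq]]; last first.
  exact: lt_le_trans (c_gt0 pq) (excess_source_ge pq).
apply: contraPP => no_q; apply/negP; rewrite -leNgt sumr_le0 // => e eF.
have [ep|_] := eqVneq; last first.
  by rewrite sub0r mulrN oppr_le0 mulr_ge0 ?ler0n // ltW ?c_gt0.
by case: no_q; exists e.2; rewrite -ep -surjective_pairing.
Qed.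

Lemma excess_lt0P q : reflect (exists p, (p, q) \in F) (excess F c q < 0)%R.
Proof.
apply: (iffP idP) => [|[p pq]]; last first.
  by rewrite -oppr_gt0; apply: lt_le_trans (c_gt0 pq) (excess_sink_le pq).
apply: contraPP => no_p; apply/negP; rewrite -leNgt sumr_ge0 // => e eF.
have [eq|_] := eqVneq e.2; last first.
  by rewrite subr0 mulr_ge0 ?ler0n // ltW ?c_gt0.
by case: no_p; exists e.1; rewrite -eq -surjective_pairing.
Qed.

Hypothesis F_nc : noncrossing F.

Lemma adjacent_edge p q : p < q -> (0 < excess F c p)%R ->
  (excess F c q < 0)%R ->
  (forall u, p < u -> u < q -> excess F c u = 0%R) ->
  (p, q) \in F /\ c (p, q) = Num.min (excess F c p) (- excess F c q)%R.
Proof.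
move=> lt_pq xp xq x0.
(* An edge from p ending before q would end at a vertex of excess 0, which is impossible for a right
   end. *)
have p_far l : (p, l) \in F -> q <= l.
  move=> pl; rewrite leqNgt; apply/negP => lt_lq; have [/= lt_pl _ _] := F_or pl.
  have /excess_lt0P: exists i, (i, l) \in F by exists p.
  by rewrite x0 // ltxx.
have q_far i : (i, q) \in F -> i <= p.
  move=> iq; rewrite leqNgt; apply/negP => lt_pi; have [/= lt_iq _ _] := F_or iq.
  have /excess_gt0P: exists l, (i, l) \in F by exists q.
  by rewrite x0 // ltxx.
(* If i < p and q < l, then (i, q) and (p, l) cross. So q is the only neighbour of p or p the only
   one of q, which is why the coefficient is a minimum. *)
have dicho i l : (p, l) \in F -> (i, q) \in F -> i = p \/ l = q.
  move=> pl iq; have := p_far _ pl; have := q_far _ iq.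
  rewrite leq_eqVlt => /orP[/eqP/val_inj|ip]; first by left.
  rewrite leq_eqVlt => /orP[/eqP/val_inj|ql]; first by right.
  by case: (F_nc ip lt_pq ql).
have [l pl] := excess_gt0P _ xp; have [i iq] := excess_lt0P _ xq.
have pq : (p, q) \in F by case: (dicho _ _ pl iq) => E; rewrite -?E // in pl *.
split=> //; have cp := excess_source_ge pq; have cq := excess_sink_le pq.
have [[l' pl' l'q]|only] := pselect (exists2 l, (p, l) \in F & l != q).
  suff cE : c (p, q) = (- excess F c q)%R by rewrite min_r -cE.
  rewrite (excess_sink pq) opprK (bigD1 (p, q)) ?pq ?eqxx //= big1 ?addr0 //.
  move=> [e1 e2] /= /andP[/andP[eF /eqP e2q]]; rewrite e2q in eF *.
  by case: (dicho _ _ pl' eF) => E; [rewrite E eqxx | rewrite E eqxx in l'q].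
suff cE : c (p, q) = excess F c p by rewrite min_l -cE.
rewrite (excess_source pq) (bigD1 (p, q)) ?pq ?eqxx //= big1 ?addr0 //.
move=> [e1 e2] /= /andP[/andP[eF /eqP e1p]]; rewrite e1p in eF *.
by have [->|neq] := eqVneq e2 q; rewrite ?eqxx //; case: only; exists e2.
Qed.

End Weighted.

Lemma alternating_sub E F : E \subset F -> alternating F -> alternating E.
Proof.
by move=> /subsetP EF alt i j k ij jk [/EF ? /EF ?]; apply: alt ij jk _.
Qed.

Lemma noncrossing_sub E F : E \subset F -> noncrossing F -> noncrossing E.
Proof.
by move=> /subsetP EF nc i j k l ij jk kl [/EF ? /EF ?]; apply: nc ij jk kl _.
Qed.

Lemma graph_on_sub V E F : E \subset F -> graph_on V F -> graph_on V E.
Proof. by move=> /subsetP EF gF e /EF/gF. Qed.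

Lemma excess_D1 F c e u : e \in F ->
  excess F c u =
    (c e * ((e.1 == u)%:R - (e.2 == u)%:R) + excess (F :\ e) c u)%R.
Proof.
move=> eF; rewrite /excess (bigD1 e) //=; congr (_ + _)%R.
by apply: eq_bigl => f; rewrite in_setD1 andbC.
Qed.

(* If p < q are consecutive vertices of nonzero excess, positive at p and negative
   at q, then noncrossing forces (p, q) to be an edge and makes it the only edge at
   p or the only edge at q, so its coefficient is determined; remove it. *)
Lemma alternating_noncrossing_unique F F' c c' :
  alternating F -> noncrossing F -> graph_on setT F ->
  alternating F' -> noncrossing F' -> graph_on setT F' ->
  (forall e, e \in F -> 0 < c e)%R -> (forall e, e \in F' -> 0 < c' e)%R ->
  excess F c =1 excess F' c' -> F = F'.
Proof.
move: {2}#|F| (erefl #|F|) => N; elim: N F F' => [|N IHN] F F' cardF.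
  move=> _ _ _ aF' nF' oF' _ c'_gt0 xx'; rewrite (cards0_eq cardF).
  apply/esym/eqP/set0Pn => -[[p q] pq].
  have /(excess_gt0P aF' oF' c'_gt0): exists r, (p, r) \in F' by exists q.
  by rewrite -xx' (cards0_eq cardF) /excess big_set0 ltxx.
move=> aF nF oF aF' nF' oF' c_gt0 c'_gt0 xx'.
have /set0Pn[e0 e0F] : F != set0 by rewrite -cards_eq0 cardF.
have [[p q] /= pq sh] := arg_minnP (fun e : edge n => e.2 - e.1) e0F.
change (is_true ((p, q) \in F)) in pq.
have [/= lt_pq _ _] := oF _ pq.
have xp : (0 < excess F c p)%R by apply/(excess_gt0P aF oF c_gt0); exists q.
have xq : (excess F c q < 0)%R by apply/(excess_lt0P aF oF c_gt0); exists p.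
have x0 u : p < u -> u < q -> excess F c u = 0%R.
  move=> pu uq; case: (ltgtP (excess F c u) 0%R) => //.
    case/(excess_lt0P aF oF c_gt0) => i iu; have /= := sh _ iu.
    have [ip _|pi] := ltnP i p; first by case: (nF _ _ _ _ ip pu uq).
    have [/= iu' _ _] := oF _ iu; move=> le; exfalso; lia.
  case/(excess_gt0P aF oF c_gt0) => l ul; have /= := sh _ ul.
  have [lq|ql _] := leqP l q; last by case: (nF _ _ _ _ pu uq ql).
  have [/= ul' _ _] := oF _ ul; move=> le; exfalso; lia.
have [_ cE] := adjacent_edge aF oF c_gt0 nF lt_pq xp xq x0.
have [pq' c'E] : (p, q) \in F' /\
    c' (p, q) = Num.min (excess F' c' p) (- excess F' c' q)%R.
  by apply: adjacent_edge; rewrite -?xx' // => u pu uq; rewrite -xx' x0.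
rewrite -(setD1K pq) -(setD1K pq'); congr (_ |: _).
have [s s'] := (subsetDl F [set (p, q)], subsetDl F' [set (p, q)]).
apply: IHN.
- by move: cardF; rewrite (cardsD1 (p, q)) pq => -[].
- exact: alternating_sub aF.
- exact: noncrossing_sub nF.
- exact: graph_on_sub oF.
- exact: alternating_sub aF'.
- exact: noncrossing_sub nF'.
- exact: graph_on_sub oF'.
- by move=> e /(subsetP s)/c_gt0.
- by move=> e /(subsetP s')/c'_gt0.
move=> u; have := xx' u; rewrite (excess_D1 _ _ pq) (excess_D1 _ _ pq').
by rewrite cE c'E -!xx' => /addrI.
Qed.

End Alternating.

(** * Forests and trees *)

Section Trees.

Variable n : nat.
Implicit Types (V : {set vertex n}) (E F : {set edge n}) (u v x y : vertex n).

Lemma adj_sym E : symmetric (adj E).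
Proof. by move=> u v; rewrite /adj orbC. Qed.

Lemma connect_adj_sym E : connect_sym (adj E).
Proof. exact/sym_connect_sym/adj_sym. Qed.

Lemma adj_sub E F : E \subset F -> subrel (adj E) (adj F).
Proof. by move=> /subsetP EF u v /orP[]/EF; rewrite /adj => ->; rewrite ?orbT. Qed.

Lemma connect_adj_sub E F : E \subset F -> subrel (connect (adj E)) (connect (adj F)).
Proof. by move=> EF; apply: connect_sub => u v /(adj_sub EF)/connect1. Qed.

Lemma acyclic_sub E F : E \subset F -> acyclic F -> acyclic E.
Proof.
move=> EF acF c c2 /andP[cyc uc]; apply: (acF c c2).
by rewrite /ucycle uc andbT; apply: sub_cycle cyc; apply: adj_sub.
Qed.

Lemma adj_mkedge V E u v : graph_on V E -> adj E u v -> mkedge u v \in E.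
Proof.
move=> gE /orP[] uv; have [/= lt_uv _ _] := gE _ uv; rewrite /mkedge ?lt_uv //.
by rewrite ltnNge ltnW.
Qed.

Lemma mkedge_adj E u v : mkedge u v \in E -> adj E u v.
Proof. by rewrite /mkedge /adj; case: ifP => _ ->; rewrite ?orbT. Qed.

Lemma adj_neq V E u v : graph_on V E -> adj E u v -> u != v.
Proof. by move=> gE /orP[]/gE[/= lt_uv _ _]; rewrite -val_eqE /=; lia. Qed.

Lemma adj_in V E u v : graph_on V E -> adj E u v -> u \in V /\ v \in V.
Proof. by move=> gE /orP[]/gE[]. Qed.

(** A simple path from u to v that avoids the edge has at least two steps, and the edge closes it to
    a cycle on at least three vertices, as [acyclic] requires. *)
Lemma bridge V E u v : graph_on V E -> acyclic E -> adj E u v ->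
  ~~ connect (adj (E :\ mkedge u v)) u v.
Proof.
move=> gE acE uv; apply/negP => /connectP[p0].
case/shortenP=> p pp up _ def_v; case: p => [|y [|z p]] in pp up def_v.
- by have := adj_neq gE uv; rewrite def_v eqxx.
- move: pp; rewrite /= andbT -[y]/(last u [:: y]) -def_v => uv'.
  have := adj_mkedge (graph_on_sub (subsetDl _ _) gE) uv'.
  by rewrite !inE eqxx.
apply: (acE [:: u, y, z & p]) => //; rewrite /ucycle up andbT.
rewrite -[X in cycle _ X]/(u :: (y :: z :: p)) (cycle_path u) /=.
have -> : last z p = v by rewrite def_v.
rewrite adj_sym uv /=; apply: sub_path pp => a b; apply: adj_sub; exact: subsetDl.
Qed.

(** If u and v differ, the first edge uy of a simple path in F1 is a bridge of E; yet u is joined to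
    v inside F2 and v to y by the rest of the path. *)
Lemma acyclic_disjoint V E F1 F2 u v : graph_on V E -> acyclic E ->
  F1 \subset E -> F2 \subset E -> [disjoint F1 & F2] ->
  connect (adj F1) u v -> connect (adj F2) u v -> u = v.
Proof.
move=> gE acE sF1 sF2 dF /connectP[p0].
case/shortenP=> [[|y p] pp up _ def_v cF2]; first by [].
have /andP[uy yp] := pp; have uyE : adj E u y by apply: adj_sub uy.
case/negP: (bridge gE acE uyE); rewrite connect_adj_sym.
have e1 : mkedge u y \in F1 by apply: adj_mkedge uy; apply: graph_on_sub gE.
apply: (@connect_trans _ _ v).
  apply/connectP; exists p => //; move: yp.
  have: all (predC1 u) (y :: p).
    by apply/allP => z zp; apply/eqP => zu; move: up; rewrite /= -zu zp.
  apply: (sub_in_path (P := predC1 u)) => a b /= au bu.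
  have neq e : e \in [:: (a, b); (b, a)] -> e != mkedge u y.
    rewrite !inE /mkedge; case: ifP => _ /orP[]/eqP->; rewrite xpair_eqE;
    by rewrite ?(negPf au) ?(negPf bu) ?andbF.
  by rewrite /adj => /orP[] /(subsetP sF1) H; rewrite !in_setD1 H !neq ?inE ?eqxx ?orbT.
rewrite connect_adj_sym; apply: connect_adj_sub cF2; apply/subsetP => e eF2.
rewrite in_setD1 (subsetP sF2) // andbT; apply/eqP => ee.
by have := disjointFr dF e1; rewrite -ee eF2.
Qed.

Lemma next_at_last (A : eqType) (y0 y : A) (p : seq A) :
  uniq (y :: p) -> next_at (last y p) y0 y p = y0.
Proof.
elim: p y => [|a p IHp] y /=; first by rewrite eqxx.
move=> /andP[yap uap]; rewrite IHp // ifN //.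
by apply: contraNneq yap => <-; apply: mem_last.
Qed.

(* In a cycle, the two neighbours of a shortest edge would cross. *)
Lemma alternating_noncrossing_acyclic V E :
  graph_on V E -> alternating E -> noncrossing E -> acyclic E.
Proof.
move=> gE aE nE c c2 /andP[cyc uc].
(* Subtraction is truncated, so the sum is the distance between x and its successor. *)
pose d (x : vertex n) := (x - next c x) + (next c x - x).
have [x0 x0c] : exists x0, x0 \in c.
  by case: c c2 {cyc uc d} => // x; exists x; rewrite mem_head.
have [x xc x_min] := arg_minnP (P := mem c) d x0c.
have [i s def_c] := rot_to xc.
have cyc' : cycle (adj E) (x :: s) by rewrite -def_c rot_cycle.
have uc' : uniq (x :: s) by rewrite -def_c rot_uniq.
have dE z : d z = (z - next (x :: s) z) + (next (x :: s) z - z).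
  by rewrite /d -def_c next_rot.
have mem_c z : (z \in c) = (z \in x :: s) by rewrite -def_c mem_rot.
have sz : 2 < size (x :: s) by rewrite -def_c size_rot.
case: s => [|y [|z t]] // in def_c cyc' uc' dE mem_c sz.
set w := last z t.
have wzt : w \in z :: t by apply: mem_last.
have [xy xw yw yz xz] : [/\ x != y, x != w, y != w, y != z & x != z].
  have /and3P[xn yn _] := uc'.
  have zzt := mem_head z t.
  split; [apply: contraNneq xn => -> | apply: contraNneq xn => ->
    | apply: contraNneq yn => -> | apply: contraNneq yn => ->
    | apply: contraNneq xn => ->]; rewrite ?mem_head // inE ?wzt ?zzt orbT //.
have dx : d x = (x - y) + (y - x) by rewrite dE /= eqxx.
have dy : d y = (y - z) + (z - y) by rewrite dE /= eq_sym (negPf xy) eqxx.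
have dw : d w = (w - x) + (x - w).
  rewrite dE -[next _ w]/(next_at (last x [:: y, z & t]) x x [:: y, z & t]).
  by rewrite next_at_last.
have {}dE : d x <= d y by apply: x_min; rewrite /= mem_c !inE eqxx orbT.
have {}x_min : d x <= d w by apply: x_min; rewrite /= mem_c !inE -in_cons wzt !orbT.
move: cyc'; rewrite (cycle_path x) /= -/w => /and4P[wx xy' yz' _].
move: dE x_min wx xy' yz' xy xw yw yz xz; rewrite dx dy dw /adj -!val_eqE /=.
move=> dxy dxw wx xy yz neq_xy neq_xw neq_yw neq_yz neq_xz.
have gt a b : (a, b) \in E -> a < b by case/gE.
have na a b b' : (a, b) \in E -> (b, b') \in E -> False.
  by move=> ab bb'; apply: (aE a b b'); rewrite ?gt.
(* By alternation one end of the shortest edge xy is only a left end and the other only a right end.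
   So w lies beyond y and z beyond x, and the edges xw and yz cross. *)
case/orP: xy => xy; have lt_xy := gt _ _ xy.
  have xw : (x, w) \in E by case/orP: wx => // /na/(_ xy).
  have zy : (z, y) \in E by case/orP: yz => // /(na _ _ _ xy).
  have [lt_xw lt_zy] := (gt _ _ xw, gt _ _ zy).
  have [zx yw] : z < x /\ y < w by clear - dxy dxw neq_xz neq_yw lt_xw lt_zy lt_xy; lia.
  exact: (nE z x y w zx lt_xy yw).
have wx' : (w, x) \in E by case/orP: wx => // /(na _ _ _ xy).
have yz'' : (y, z) \in E by case/orP: yz => // /na/(_ xy).
have [lt_wx lt_yz] := (gt _ _ wx', gt _ _ yz'').
have [wy xz] : w < y /\ x < z by clear - dxy dxw neq_xz neq_yw lt_wx lt_yz lt_xy; lia.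
exact: (nE w y x z wy lt_xy xz).
Qed.

(** Sum the excess over the component of a after removal of the bridge (a, b): every other edge has
    both ends inside or both outside, so c (a, b) alone remains. *)
Lemma acyclic_indep (w : seq (edge n)) :
  uniq w -> graph_on setT [set:: w] -> acyclic [set:: w] -> indep w.
Proof.
move=> uw gw acw c c0 [a b] eE.
have {}eE : (a, b) \in [set:: w] by rewrite inE.
have [/= lt_ab _ _] := gw _ eE; set E := [set:: w] in eE gw acw.
have ab : adj E a b by rewrite /adj eE.
have mk : mkedge a b = (a, b) by rewrite /mkedge lt_ab.
pose U := [set u | connect (adj (E :\ (a, b))) a u].
have aU : a \in U by rewrite inE connect0.
have bU : b \notin U by have := bridge gw acw ab; rewrite inE mk.
have : (\sum_(u in U) excess E c u = 0)%R.
  by apply: big1 => u _; rewrite -flow_coord // c0 mxE.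
have ind x : (\sum_(u in U) (x == u)%:R = (x \in U)%:R :> rat)%R.
  have [xU|xU] := boolP (x \in U).
    rewrite (bigD1 x) //= eqxx big1 ?addr0 // => u /andP[_].
    by rewrite eq_sym => /negPf->.
  by rewrite big1 // => u uU; case: eqP => // xu; rewrite xu uU in xU.
have cut f : (\sum_(u in U) c f * ((f.1 == u)%:R - (f.2 == u)%:R) =
              c f * ((f.1 \in U)%:R - (f.2 \in U)%:R) :> rat)%R.
  by rewrite -mulr_sumr sumrB !ind.
rewrite /excess exchange_big /= (bigD1 (a, b)) //= [X in (_ + X)%R]big1 ?addr0.
  by rewrite cut /= aU (negPf bU) subr0 mulr1.
move=> f /andP[fE fab].
rewrite cut; suff -> : (f.1 \in U) = (f.2 \in U) by rewrite subrr mulr0.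
rewrite !inE; apply: same_connect_r; first exact: connect_adj_sym.
by apply: connect1; rewrite /adj in_setD1 -surjective_pairing fE fab.
Qed.

Lemma root_vec_dot (y : vertex n -> rat) (e : edge n) :
  (\sum_u y u * root_vec e ord0 u = y e.1 - y e.2)%R.
Proof.
have pick a : (\sum_u y u * (u == a)%:R = y a)%R.
  rewrite (bigD1 a) //= eqxx mulr1 big1 ?addr0 // => u /negPf->.
  by rewrite mulr0.
by rewrite -!pick -sumrB; apply: eq_bigr => u _; rewrite !mxE !eqxx /= mulrBr.
Qed.

(* The incidence matrix has full row rank by independence, and only the constant
   vectors in its kernel by connectedness. *)
Lemma tree_size (w : seq (edge n)) : uniq w -> indep w ->
  (forall u v, connect (adj [set:: w]) u v) -> size w = n.
Proof.
move=> uw iw cw.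
have [M rowM] : exists M : 'M[rat]_(size w, n.+1),
    forall k, row k M = root_vec (tnth (in_tuple w) k).
  by exists (\matrix_(k < size w) root_vec (tnth (in_tuple w) k))%R => k; rewrite rowK.
have MT k u : M k u = root_vec (tnth (in_tuple w) k) ord0 u.
  by rewrite -rowM mxE.
have rM : \rank M = size w.
  apply/eqP/inj_row_free => v vM0; apply/rowP => k; rewrite mxE.
  (* The entries of [v] as coefficients of edges; the value 0 outside [w] is arbitrary. *)
  pose c e : rat := (if insub (index e w) is Some k then v ord0 k else 0)%R.
  have cE k' : c (tnth (in_tuple w) k') = v ord0 k'.
    rewrite /c (tnth_nth (tnth (in_tuple w) k')) index_uniq //= ?ltn_ord //.
    by rewrite valK.
  rewrite -cE; apply: iw; last exact: mem_tnth.
  rewrite /flow big_tnth -[RHS]vM0 mulmx_sum_row.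
  by apply: eq_bigr => k' _; rewrite rowM cE.
have rK : \rank (kermx (trmx M)) = 1%N.
  have <- : \rank (const_mx 1%R : 'rV[rat]_n.+1) = 1%N.
    rewrite rank_rV; case: eqP => // /rowP/(_ ord0); rewrite !mxE => /eqP.
    by rewrite oner_eq0.
  apply/eqmx_rank/andP; split; last first.
    apply/sub_kermxP/rowP => k; rewrite !mxE.
    transitivity (\sum_u 1 * root_vec (tnth (in_tuple w) k) ord0 u : rat)%R.
      by apply: eq_bigr => u _; rewrite -MT mxE [trmx M _ _]mxE.
    by rewrite root_vec_dot subrr.
  apply/rV_subP => v /sub_kermxP/rowP vM0.
  suff -> : v = (v ord0 ord0 *: const_mx 1)%R by apply: scalemx_sub.
  apply/rowP => u; rewrite !mxE mulr1.
  have v_adj x y : adj [set:: w] x y -> v ord0 x = v ord0 y.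
    have main e : e \in w -> v ord0 e.1 = v ord0 e.2.
      move=> ew; have [k ->] : exists k, e = tnth (in_tuple w) k by apply/tnthP.
      apply/eqP; rewrite -subr_eq0 -(root_vec_dot (fun u => v ord0 u)).
      apply/eqP; move: (vM0 k); rewrite mxE [RHS]mxE; apply: etrans.
      apply: eq_bigr => u' _.
      by rewrite [trmx M _ _]mxE MT.
    by rewrite /adj !inE => /orP[] /main.
  have /connectP[p pp ->] := cw ord0 u.
  by elim: p ord0 pp => //= y p IHp x /andP[/v_adj -> /IHp].
have := mxrank_ker (trmx M); rewrite rK mxrank_tr rM => E.
by have := rank_leq_col M; rewrite rM; lia.
Qed.

End Trees.

(** * Increasing paths *)

Section Paths.

Variable n : nat.
Implicit Types (V W : {set vertex n}) (E F : {set edge n}).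
Implicit Types (u v x y : vertex n) (s : seq (vertex n)) (e : edge n).

Definition up E : rel (vertex n) := [rel u v : vertex n | (u < v) && ((u, v) \in E)].

Definition reach E : rel (vertex n) := connect (up E).

Lemma up_adj E : subrel (up E) (adj E).
Proof. by move=> u v /andP[_]; rewrite /adj => ->. Qed.

Lemma reach_leq E u v : reach E u v -> u <= v.
Proof.
case/connectP=> p pp ->; elim: p u pp => //= w p IHp u /andP[/andP[uw _] /IHp].
exact/leq_trans/ltnW.
Qed.

Lemma in_closureP E e : in_closure E e <-> e.1 < e.2 /\ reach E e.1 e.2.
Proof.
split=> [[p pp]|[lt /connectP[p pp def]]].
  have := pp; rewrite rcons_path => pp'.
  case/andP: pp' => p1 /andP[lt_l le]; split.
    apply: leq_ltn_trans lt_l; apply: (@reach_leq E).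
    by apply/connectP; exists p.
  by apply/connectP; exists (rcons p e.2); rewrite ?last_rcons.
case/lastP: p => [|p z] in pp def; first by rewrite def /= ltnn in lt.
by exists p; rewrite last_rcons in def; rewrite def.
Qed.

(** Here z is a number and not a vertex, so that the cut can be placed just below a vertex, at its
    predecessor. *)
Lemma reach_cut E u w (z : nat) : reach E u w -> u <= z -> z < w ->
  exists a b, [/\ (a, b) \in E, a <= z, z < b, reach E u a & reach E b w].
Proof.
case/connectP=> p; elim: p u => [|v p IHp] u /=; first by move=> _ ->; lia.
case/andP=> uv pp def_w uz zw; have [vz|zv] := leqP v z.
  have [a [b [abE az zb va bw]]] := IHp _ pp def_w vz zw; exists a, b; split=> //.
  exact: connect_trans (connect1 uv) va.
exists u, v; case/andP: uv => _ uvE; split=> //; first exact: connect0.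
by apply/connectP; exists p.
Qed.

(** Discrete intermediate values: the edge is the step by which the path first gets above y. *)
Lemma path_cross (r : rel (vertex n)) x s y :
  path r x s -> x < y -> y < last x s -> y \notin s ->
  exists u v, [/\ r u v, u < y, y < v, u \in x :: s & v \in x :: s].
Proof.
elim: s x => [|v s IHs] x /=; first by lia.
case/andP=> xv ps xy yl; rewrite inE negb_or => /andP[yv ys].
have [vy|] := ltnP v y.
  have [a [b [rab ay yb as_ bs]]] := IHs v ps vy yl ys.
  by exists a, b; rewrite ![_ \in x :: _]inE as_ bs !orbT.
rewrite leq_eqVlt val_eqE (negPf yv) /= => lt_yv.
by exists x, v; rewrite !inE !eqxx orbT.
Qed.

Lemma up_path_reach E x s y : path (up E) x s -> y \in x :: s ->
  reach E x y /\ reach E y (last x s).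
Proof.
elim: s x => [|v s IHs] x /=.
  by move=> _; rewrite inE => /eqP->; split; apply: connect0.
case/andP=> xv ps; rewrite inE => /predU1P[->|ys].
  split; first exact: connect0.
  by apply/connectP; exists (v :: s); rewrite //= xv.
have [vy yl] := IHs _ ps ys; split=> //; exact: connect_trans (connect1 xv) vy.
Qed.

Lemma path_edges_cons x y s : path_edges x (y :: s) = mkedge x y |: path_edges y s.
Proof. by apply/setP => e; rewrite !inE. Qed.

Lemma path_edges_ends x s e :
  e \in path_edges x s -> e.1 \in x :: s /\ e.2 \in x :: s.
Proof.
elim: s x => [|y s IHs] x; first by rewrite inE.
rewrite path_edges_cons in_setU1 => /predU1P[->|/IHs[]].
  by rewrite /mkedge; case: ifP; rewrite !inE !eqxx ?orbT.
by rewrite ![_ \in x :: _]inE => -> ->; rewrite !orbT.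
Qed.

Lemma path_edges_sub V E x s :
  graph_on V E -> path (adj E) x s -> path_edges x s \subset E.
Proof.
move=> gE; elim: s x => [|y s IHs] x /=; first by rewrite sub0set.
case/andP=> xy ps; rewrite path_edges_cons subUset IHs // andbT sub1set.
exact: adj_mkedge gE xy.
Qed.

Lemma path_edges_up E x s e : path (up E) x s -> e \in path_edges x s ->
  [/\ e \in E, reach E x e.1 & reach E e.2 (last x s)].
Proof.
elim: s x => [|y s IHs] x; first by rewrite inE.
move=> /= /andP[xy ps]; rewrite path_edges_cons in_setU1 => /predU1P[->|eP].
  have /andP[lt_xy xyE] := xy; rewrite /mkedge lt_xy /=; split=> //.
    exact: connect0.
  by apply/connectP; exists s.
have [eE ye el] := IHs y ps eP; split=> //; exact: connect_trans (connect1 xy) ye.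
Qed.

Lemma path_edges_connect x s y :
  y \in x :: s -> connect (adj (path_edges x s)) x y.
Proof.
elim: s x => [|z s IHs] x; first by rewrite inE => /eqP->; apply: connect0.
rewrite inE => /predU1P[->|ys]; first exact: connect0.
rewrite path_edges_cons; apply: (@connect_trans _ _ z).
  by apply: connect1; apply: mkedge_adj; rewrite in_setU1 eqxx.
by apply: connect_adj_sub (IHs z ys); apply: subsetUr.
Qed.

(** If a later vertex y lay below the second vertex v, the path would have to return from y past v,
    by an edge that crosses (x, v). *)
Lemma noncrossing_path_up V E x s :
  graph_on V E -> noncrossing E -> path (adj E) x s -> uniq (x :: s) ->
  (forall y, y \in s -> x < y) -> (forall y, y \in s -> y <= last x s) ->
  path (up E) x s.
Proof.
move=> gE nE; elim: s x => [|v s IHs] x //= /andP[xv ps] /andP[xvs /andP[vs us]].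
move=> gt_x le_l; have lt_xv : x < v by apply: gt_x; rewrite mem_head.
have xvE : (x, v) \in E.
  by case/orP: xv => // /gE[/= lt_vx _ _]; lia.
rewrite {1}/up /= lt_xv xvE /=; apply: IHs => //=; first by rewrite vs.
  move=> y ys; rewrite ltnNge leq_eqVlt; apply/negP => /orP[/eqP/val_inj yv|lt_yv].
    by rewrite -yv ys in vs.
  case/splitPr: ys ps vs us gt_x le_l => s1 s2; rewrite cat_path last_cat /=.
  case/and3P=> _ _ ps2 vs us gt_x le_l.
  have v_s2 : v \notin s2 by move: vs; rewrite mem_cat inE !negb_or => /and3P[].
  have lt_vl : v < last y s2.
    have := le_l v (mem_head _ _); rewrite leq_eqVlt => /orP[/eqP/val_inj vl|//].
    by case/negP: vs; rewrite vl mem_cat mem_last orbT.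
  have [a [b [ab av vb ays bys]]] := path_cross ps2 lt_yv lt_vl v_s2.
  have lt_xa : x < a by apply: gt_x; rewrite inE mem_cat ays !orbT.
  have abE : (a, b) \in E.
    by case/orP: ab => // /gE[/= lt_ba _ _]; lia.
  exact: (nE x a v b).
by move=> y ys; apply: le_l; rewrite inE ys orbT.
Qed.

End Paths.

(** * Pseudo-components *)

Section PseudoComponents.

Variable n : nat.
Implicit Types (V W : {set vertex n}) (E F : {set edge n}).
Implicit Types (u v x y : vertex n) (s : seq (vertex n)) (e : edge n).

Lemma path_split (r : rel (vertex n)) x s v : path r x s -> v \in x :: s ->
  exists s1 s2, [/\ path r x s1, last x s1 = v, path r v s2,
    last v s2 = last x s & {subset s1 <= x :: s} /\ {subset s2 <= x :: s}].
Proof.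
move=> ps vs; case/splitPl: vs ps => s1 s2 def_v.
rewrite cat_path last_cat def_v => /andP[p1 p2]; exists s1, s2; split=> //.
by split=> z zs; rewrite inE mem_cat zs ?orbT.
Qed.

Lemma adj_path_in V E x s : graph_on V E -> path (adj E) x s -> x \in V ->
  {subset x :: s <= V}.
Proof.
move=> gE; elim: s x => [|y s IHs] x /=; first by move=> _ xV z; rewrite inE => /eqP->.
case/andP=> xy ps xV z; rewrite inE => /predU1P[->//|]; apply: IHs => //.
by case: (adj_in gE xy).
Qed.

Section MinMaxPath.
Variables (V : {set vertex n}) (E : {set edge n}).
Variables (x : vertex n) (s : seq (vertex n)).
Hypotheses (gE : graph_on V E) (acE : acyclic E) (nE : noncrossing E).
Hypothesis mmp : min_max_path V E x s.

Lemma min_max_path_sub : {subset x :: s <= V}.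
Proof. by case: mmp => ps _ [xV _] _; apply: adj_path_in ps xV. Qed.

Lemma min_max_path_up : path (up E) x s.
Proof.
have [ps us [_ x_min] [_ l_max]] := mmp.
apply: (noncrossing_path_up gE nE ps us).
- move=> y ys; rewrite ltn_neqAle x_min ?min_max_path_sub ?inE ?ys ?orbT // andbT.
  by rewrite val_eqE; apply: contraTneq us => -> /=; rewrite ys.
- by move=> y ys; rewrite l_max // min_max_path_sub // inE ys orbT.
Qed.

(** If a were off the path, the portion of the path before v would pass over a by an edge ending at
    most at v, and (a, b) would cross it; likewise for b after v. *)
Lemma edge_over_path a b v : v \in x :: s -> (a, b) \in E -> a < v -> v < b ->
  a \in x :: s /\ b \in x :: s.
Proof.
move=> vs abE av vb; have [_ _ [_ x_min] [_ l_max]] := mmp.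
have [/= _ aV bV] := gE abE.
have [s1 [s2 [p1 l1 p2 l2 [sub1 sub2]]]] := path_split min_max_path_up vs.
split; apply: contraT => nin.
  have xa : x < a.
    rewrite ltn_neqAle x_min // andbT val_eqE eq_sym.
    by apply: contraNneq nin => ->; rewrite mem_head.
  have [||c [d [/andP[_ cdE] ca ad _ ds]]] := path_cross p1 xa.
  - by rewrite l1.
  - by apply: contra nin => /sub1.
  have [_ /reach_leq] := up_path_reach p1 ds; rewrite l1 => dv.
  by case: (nE ca ad (leq_ltn_trans dv vb)).
have bl : b < last v s2.
  rewrite ltn_neqAle l2 l_max // andbT val_eqE.
  by apply: contraNneq nin => ->; rewrite mem_last.
have [|c [d [/andP[_ cdE] cb bd cs _]]] := path_cross p2 vb bl.
  by apply: contra nin => /sub2.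
have [/reach_leq vc _] := up_path_reach p2 cs.
by case: (nE (leq_trans av vc) cb bd).
Qed.

Lemma path_edges_subE : path_edges x s \subset E.
Proof. by case: mmp => ps _ _ _; exact: path_edges_sub gE ps. Qed.

Section Part.
Variables (W : {set vertex n}) (F : {set edge n}).
Hypotheses (tF : tree_on W F) (sF : F \subset E :\: path_edges x s).

Lemma part_sub : F \subset E.
Proof. exact: subset_trans sF (subsetDl _ _). Qed.

(** Two common vertices would be joined inside F and also along the path, by disjoint sets of
    edges. *)
Lemma part_meets_path_once u v :
  u \in x :: s -> v \in x :: s -> u \in W -> v \in W -> u = v.
Proof.
move=> us vs uW vW; apply: (acyclic_disjoint gE acE path_edges_subE part_sub).
- rewrite disjoint_sym disjoints_subset.
  by apply: subset_trans sF _; rewrite setDE subsetIr.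
- apply: (@connect_trans _ _ x); last exact: path_edges_connect.
  by rewrite connect_adj_sym; apply: path_edges_connect.
- by case: tF => _ _; apply.
Qed.

(** Otherwise an edge of F passes over v; by [edge_over_path] both its ends lie on the path, which
    the part meets only once. *)
Lemma part_one_side v a b : v \in x :: s -> v \notin W -> a \in W -> b \in W ->
  a < v -> b < v.
Proof.
move=> vs vW aW bW av; rewrite ltnNge leq_eqVlt; apply/negP => /orP[|vb].
  by move=> /eqP/val_inj vb; rewrite vb bW in vW.
have [_ [gF _] cF] := tF; have /connectP[p pp def_b] := cF _ _ aW bW.
have p_W := adj_path_in gF pp aW; rewrite def_b in vb.
have [|c [d [cd cv vd cp dp]]] := path_cross pp av vb.
  by apply: contra vW => vp; apply: p_W; rewrite inE vp orbT.
have cdF : (c, d) \in F by case/orP: cd => // /gF[/= dc _ _]; lia.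
have [cs ds] := edge_over_path vs (subsetP part_sub _ cdF) cv vd.
have := part_meets_path_once cs ds (p_W _ cp) (p_W _ dp) => cd_eq.
by move: (ltn_trans cv vd); rewrite cd_eq ltnn.
Qed.

End Part.
(** Serves to merge two parts sharing a vertex p off the path. As the parts already meet in p, v is
    not in W'; so W' lies on one side of v, the side of p, where W lies too. *)
Lemma merged_extreme W F W' F' p v :
  tree_on W F -> F \subset E :\: path_edges x s ->
  tree_on W' F' -> F' \subset E :\: path_edges x s -> [disjoint F & F'] ->
  p \in W -> p \in W' -> p \notin x :: s -> v \in x :: s -> v \in W ->
  smallest W v \/ largest W v ->
  smallest (W :|: W') v \/ largest (W :|: W') v.
Proof.
move=> tF sF tF' sF' dF pW pW' ps vs vW.
have vp : v != p by apply: contraNneq ps => <-.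
have vW' : v \notin W'.
  apply: contra vp => vW'; apply/eqP.
  apply: (acyclic_disjoint gE acE (part_sub sF) (part_sub sF') dF).
    by case: tF => _ _; apply.
  by case: tF' => _ _; apply.
have one_side := part_one_side tF' sF' vs vW'.
case=> -[_ ext]; [left | right]; split; rewrite ?inE ?vW // => w.
  rewrite inE => /orP[/ext//|wW']; rewrite leqNgt; apply/negP => wv.
  by have := one_side _ _ wW' pW' wv; rewrite ltnNge ext.
rewrite inE => /orP[/ext//|wW']; apply/ltnW/(one_side p) => //.
by rewrite ltn_neqAle ext // andbT val_eqE eq_sym.
Qed.

End MinMaxPath.

Lemma pairwise_perm (A : eqType) (r : rel A) (l l' : seq A) :
  symmetric r -> perm_eq l l' -> pairwise r l -> pairwise r l'.
Proof.
move=> r_sym; elim: l l' => [|a l IHl] l' ll'.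
  by move: ll'; rewrite perm_sym => /perm_nilP->.
have al' : a \in l' by rewrite -(perm_mem ll') mem_head.
case/splitPr: al' ll' => l1 l2.
rewrite perm_sym -cat1s perm_catCA /= perm_cons perm_sym => ll'.
rewrite /= (perm_all _ ll') all_cat => /andP[/andP[a1 a2] pl].
rewrite -cat1s pairwise_mid allrel1l a2 /= IHl //.
by rewrite allrelr1 andbT; apply: sub_all a1 => b; rewrite r_sym.
Qed.

Lemma mem_bigcup_seq (A B : finType) (f : A -> {set B}) (l : seq A) b :
  reflect (exists2 a, a \in l & b \in f a) (b \in \bigcup_(a <- l) f a).
Proof.
elim: l => [|a l IHl]; first by rewrite big_nil inE; right=> -[].
rewrite big_cons inE; apply: (iffP orP) => [[ba|/IHl[a' a'l ba']]|[a']].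
- by exists a; rewrite ?mem_head.
- by exists a'; rewrite // inE a'l orbT.
- rewrite inE => /predU1P[->|a'l] ba; [by left | right].
  by apply/IHl; exists a'.
Qed.

Section MinSplitting.
Variables (V : {set vertex n}) (E : {set edge n}).
Variables (x : vertex n) (s : seq (vertex n)).
Hypotheses (gE : graph_on V E) (acE : acyclic E) (nE : noncrossing E).
Hypothesis mmp : min_max_path V E x s.

Notation graph := ({set vertex n} * {set edge n})%type.
Variable D : seq graph.

Lemma splitting_part_sub W F : splitting E x s D -> (W, F) \in D ->
  F \subset E :\: path_edges x s.
Proof.
move=> [_ _ <- _] WFD; apply/subsetP => e eF.
by apply/mem_bigcup_seq; exists (W, F).
Qed.

(* Otherwise some other part of D contains p, and merging the two parts gives a
   splitting with one part less. *)
Lemma min_splitting_part_full W F e p : min_splitting E x s D ->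
  (W, F) \in D -> p \in W -> p \notin x :: s -> e \in E ->
  (e.1 == p) || (e.2 == p) -> e \in F.
Proof.
move=> [spl minD] WFD pW ps eE ep; have [treeD disD covD extD] := spl.
have : e \in E :\: path_edges x s.
  rewrite inE eE andbT; apply: contra ps => /path_edges_ends[].
  by case/orP: ep => /eqP->.
rewrite -covD => /mem_bigcup_seq[[W' F'] WFD' /= eF'].
have pW' : p \in W'.
  have [_ [gF' _] _] := treeD _ _ WFD'.
  by have [_] := gF' _ eF'; case/orP: ep => /eqP->.
have [[_ <-] //|neq] := eqVneq (W', F') (W, F).
have [D0 permD] : exists D0, perm_eq D [:: (W, F), (W', F') & D0].
  exists (rem (W', F') (rem (W, F) D)).
  apply: perm_trans (perm_to_rem WFD) _; rewrite perm_cons perm_to_rem //.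
  by move: WFD'; rewrite (perm_mem (perm_to_rem WFD)) inE (negPf neq).
have mem_D := perm_mem permD.
have [tF tF'] := (treeD _ _ WFD, treeD _ _ WFD').
have [sF sF'] := (splitting_part_sub spl WFD, splitting_part_sub spl WFD').
have g_sym : symmetric (fun G1 G2 : graph => [disjoint G1.2 & G2.2]).
  by move=> G1 G2; rewrite disjoint_sym.
move: disD => /(pairwise_perm g_sym permD) /= /and3P[/andP[dF dF0] dF'0 dD0].
have dF' : [disjoint F' & F] by rewrite disjoint_sym.
case: (minD ((W :|: W', F :|: F') :: D0)); first by rewrite (perm_size permD).
split.
- move=> W1 F1; rewrite inE => /predU1P[[-> ->]|D0F1]; last first.
    by apply: treeD; rewrite mem_D !inE D0F1 !orbT.
  have [_ [gF _] cF] := tF; have [_ [gF' _] cF'] := tF'.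
  have conn q : q \in W :|: W' -> connect (adj (F :|: F')) q p.
    rewrite inE => /orP[] qW.
      by apply: connect_adj_sub (subsetUl _ _) _ _ _; apply: cF.
    by apply: connect_adj_sub (subsetUr _ _) _ _ _; apply: cF'.
  split; first by apply/set0Pn; exists p; rewrite inE pW.
    split.
      move=> f; rewrite inE => /orP[/gF|/gF'] [-> f1 f2];
      by rewrite !inE f1 f2 ?orbT.
    apply: acyclic_sub acE.
    by rewrite subUset (part_sub sF) (part_sub sF').
  move=> a b /conn aW /conn bW; apply: connect_trans aW _.
  by rewrite connect_adj_sym.
- rewrite /= dD0 andbT; move/allP: dF0 => dF0; move/allP: dF'0 => dF'0.
  apply/allP => G GD /=.
  by rewrite -setI_eq0 setIUl setU_eq0 !setI_eq0 dF0 // dF'0.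
- move: covD; rewrite (perm_big _ permD) /= !big_cons /= => <-.
  by rewrite setUA.
move=> W1 F1 v; rewrite inE => /predU1P[[-> _]|D0F1] vs; last first.
  by apply: (extD _ F1) => //; rewrite mem_D !inE D0F1 !orbT.
rewrite inE => /orP[] vW.
  apply: (merged_extreme gE acE nE mmp tF sF tF' sF' dF pW) => //.
  exact: extD WFD vs vW.
rewrite setUC; apply: (merged_extreme gE acE nE mmp tF' sF' tF sF dF' pW') => //.
exact: extD WFD' vs vW.
Qed.
End MinSplitting.
End PseudoComponents.

(** * Position of a pseudo-component in the whole tree *)

Section PseudoComponentShape.

Variable n : nat.
Implicit Types (V W : {set vertex n}) (E F : {set edge n}).
Implicit Types (u v x y a b p : vertex n) (s : seq (vertex n)) (e : edge n).

Definition edges_within E p a b : Prop :=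
  forall e, e \in E -> (e.1 == p) || (e.2 == p) -> a <= e.1 /\ e.2 <= b.

Definition extremal V v : Prop := smallest V v \/ largest V v.

(** What is used of a pseudo-component later on. The clauses [~ extremal] carry the induction: a
    non-extremal vertex of a part lies off the path of the larger tree, where the part contains all
    edges of that tree. *)
Record pseudo_comp_shape V E x s : Prop := PseudoCompShape {
  shape_up : path (up E) x s;
  shape_sub : {subset x :: s <= V};
  shape_inner : forall p, p \in x :: s -> x < p -> p < last x s ->
    edges_within E p x (last x s);
  shape_ends : [\/ smallest V x /\ largest V (last x s),
    ~ extremal V x /\ edges_within E x x (last x s)
    | ~ extremal V (last x s) /\ edges_within E (last x s) x (last x s)]
}.

Lemma pseudo_compP V E x s : pseudo_comp V E x s -> tree_on V E ->
  noncrossing E -> x < last x s -> pseudo_comp_shape V E x s.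
Proof.
elim=> {V E x s} [V E x s mmp|V E x s D W F y t mmp minD WFD _ IHs] tE nE lt_ends.
  have [_ [gE acE] _] := tE; have [_ _ sx lx] := mmp.
  split.
  - exact: min_max_path_up gE nE mmp.
  - exact: min_max_path_sub gE mmp.
  - move=> p ps _ _ e /gE[_ e1 e2] _; case: sx => _ sx; case: lx => _ lx.
    by split; [apply: sx | apply: lx].
  - by constructor 1.
have [_ [gE acE] _] := tE; have [spl _] := minD.
have [treeD _ _ extD] := spl; have tF := treeD _ _ WFD.
have sF := splitting_part_sub spl WFD; have FE := part_sub sF.
have [up_t tW inner_t ends_t] := IHs tF (noncrossing_sub FE nE) lt_ends.
have full := min_splitting_part_full gE acE nE mmp minD WFD.
have [_ [gF _] _] := tF.
have yW : y \in W by apply: tW; rewrite mem_head.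
have lW : last y t \in W by apply: tW; rewrite mem_last.
have ext_x v : extremal V v -> v \in x :: s.
  have [_ _ [xV sx] [lV lx]] := mmp.
  case=> -[vV ext].
    suff -> : v = x by rewrite mem_head.
    by apply/val_inj/eqP; rewrite eqn_leq ext // sx.
  suff -> : v = last x s by rewrite mem_last.
  by apply/val_inj/eqP; rewrite eqn_leq ext // andbT lx.
have within p : p \in W -> p \notin x :: s -> edges_within F p y (last y t) ->
    edges_within E p y (last y t).
  by move=> pW ps wp e eE ep; apply: wp => //; apply: full eE ep.
have up_E : path (up E) y t.
  by apply: sub_path up_t => a b /andP[ab abF]; rewrite /up /= ab (subsetP FE).
split.
- exact: up_E.
- have adj_t : path (adj E) y t by apply: sub_path up_E; apply: up_adj.
  apply: (adj_path_in gE adj_t).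
  by case: t lt_ends adj_t {up_t tW inner_t ends_t lW within up_E IHs} => [|z t] /=;
    (* The ends differ, so the path has a first edge, which puts y in V. *)
    [rewrite ltnn | move=> _ /andP[/(adj_in gE)[]]].
- move=> p pt lt_yp lt_pl; have pW := tW _ pt; apply: within => //.
    apply/negP => ps; have [[_ /(_ _ yW)]|[_ /(_ _ lW)]] := extD _ _ _ WFD ps pW.
      by rewrite leqNgt lt_yp.
    by rewrite leqNgt lt_pl.
  exact: inner_t.
case: ends_t => [[sy ll]|[ny wy]|[nl wl]].
- have wF p : edges_within F p y (last y t).
    move=> e /gF[_ e1 e2] _; case: sy => _ sy; case: ll => _ ll.
    by split; [apply: sy | apply: ll].
  (* The part meets the path of the larger tree at most once, so one of its extreme vertices lies
     off that path. *)
  have [ys|ys] := boolP (y \in x :: s); last first.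
    constructor 2; split; last exact: within.
    by move/ext_x; apply/negP.
  have ls : last y t \notin x :: s.
    apply/negP => ls; have E1 := part_meets_path_once gE acE mmp tF sF ys ls yW lW.
    by rewrite -E1 ltnn in lt_ends.
  constructor 3; split; last exact: within.
  by move/ext_x; apply/negP.
- have ys : y \notin x :: s by apply/negP => ys; apply: ny; apply: extD WFD ys yW.
  constructor 2; split; last exact: within.
  by move/ext_x; apply/negP.
- have ls : last y t \notin x :: s.
    by apply/negP => ls; apply: nl; apply: extD WFD ls lW.
  constructor 3; split; last exact: within.
  by move/ext_x; apply/negP.
Qed.

Lemma min_max_path_exists V E : tree_on V E -> exists x s, min_max_path V E x s.
Proof.
move=> [/set0Pn[v vV] _ cE].
have [a aV a_min] := arg_minnP (P := mem V) (fun u => u : nat) vV.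
have [b bV b_max] := arg_maxnP (P := mem V) (fun u => u : nat) vV.
have /connectP[p0 pp def_b] := cE a b aV bV; case/shortenP: pp def_b => p pp up _ def_b.
by exists a, p; split=> //; split=> //; rewrite -def_b // => w wV; apply: b_max.
Qed.

Lemma edge_tree V E e : graph_on V E -> acyclic E -> e \in E ->
  tree_on [set e.1; e.2] [set e].
Proof.
move=> gE acE eE; split; first by apply/set0Pn; exists e.1; rewrite !inE eqxx.
  split; last by apply: acyclic_sub acE; rewrite sub1set.
  by move=> f; rewrite inE => /eqP->; have [-> _ _] := gE _ eE; rewrite !inE !eqxx orbT.
have e12 : connect (adj [set e]) e.1 e.2.
  by apply: connect1; rewrite /adj -surjective_pairing inE eqxx.
move=> u v; rewrite !inE => /orP[]/eqP-> /orP[]/eqP-> //; try exact: connect0.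
by rewrite connect_adj_sym.
Qed.

Lemma min_splitting_exists V E x s :
  graph_on V E -> acyclic E -> exists D, min_splitting E x s D.
Proof.
move=> gE acE; pose R := E :\: path_edges x s.
(* The single edges form a splitting. *)
have [N] : exists N, `[< exists2 D, size D = N & splitting E x s D >].
  pose D := [seq ([set e.1; e.2], [set e]) | e <- enum R].
  exists (size D); apply/asboolP; exists D => //; split.
  - move=> W F /mapP[e]; rewrite mem_enum => /setDP[eE _] [-> ->].
    exact: edge_tree gE acE eE.
  - rewrite pairwise_map; have := enum_uniq R; rewrite uniq_pairwise.
    by apply: sub_pairwise => e f ef /=; rewrite disjoints1 inE.
  - rewrite big_map /= big_enum /=; apply/setP => e; apply/bigcupP/idP => [[f fR]|eR].
      by rewrite inE => /eqP->.
    by exists e; rewrite ?set11.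
  - move=> W F v /mapP[e]; rewrite mem_enum => /setDP[eE _] [-> _] _.
    have [lt_e _ _] := gE _ eE; rewrite !inE => /orP[]/eqP->; [left | right].
      split; first by rewrite !inE eqxx.
      by move=> w; rewrite !inE => /orP[]/eqP-> //; apply: ltnW.
    split; first by rewrite !inE eqxx orbT.
    by move=> w; rewrite !inE => /orP[]/eqP-> //; apply: ltnW.
move=> exN; have /ex_minnP[m /asboolP[D szD spl] min_m] : exists N,
    `[< exists2 D, size D = N & splitting E x s D >] by exists N.
exists D; split=> // D' szD' spl'.
have := min_m (size D'); rewrite -szD -szD' ltnn => H; apply: notF; apply: H.
by apply/asboolP; exists D'.
Qed.

Lemma pseudo_comp_cover V E e : tree_on V E -> e \in E ->
  exists x s, pseudo_comp V E x s /\ e \in path_edges x s.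
Proof.
move: {2}#|E|.+1 (ltnSn #|E|) => N; elim: N V E => // N IHN V E; rewrite ltnS => leEN.
move=> tE eE; have [_ [gE acE] _] := tE.
have [x [s mmp]] := min_max_path_exists tE.
have [eP|eP] := boolP (e \in path_edges x s).
  by exists x, s; split=> //; apply: PseudoPath.
have [D minD] := min_splitting_exists x s gE acE.
have [[treeD _ covD _] _] := minD.
have : e \in E :\: path_edges x s by rewrite inE eP.
rewrite -covD => /mem_bigcup_seq[[W F] WFD /= eF].
have spl : splitting E x s D by case: minD.
have sF := splitting_part_sub spl WFD.
(* The path has at least one edge, because V contains the two ends of e. *)
have ltF : #|F| < #|E|.
  apply: leq_ltn_trans (subset_leq_card sF) _.
  apply/proper_card; rewrite properEneq subsetDl andbT.
  apply/eqP => /setDidPl; rewrite disjoint_sym => dis.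
  have [ps _ [xV sx] [_ lx]] := mmp; have [lt_e e1V e2V] := gE _ eE.
  case: s ps {mmp eP D minD treeD covD spl sF WFD} lx dis => [|y s] /=.
    by move=> _ lx _; have := sx _ e1V; have := lx _ e2V; lia.
  case/andP=> /(adj_mkedge gE) xyE _ _ /disjointFr/(_ _) dis.
  by have := dis (mkedge x y); rewrite path_edges_cons in_setU1 eqxx xyE => /(_ isT).
have [y [t [pc eyt]]] := IHN W F (leq_trans ltF leEN) (treeD _ _ WFD) eF.
by exists y, t; split=> //; apply: PseudoSub mmp minD WFD pc.
Qed.

End PseudoComponentShape.

(** * Admissible forests *)

Section Covering.

Variable n : nat.
Implicit Types (E F : {set edge n}).
Implicit Types (u v w x y a b : vertex n) (s : seq (vertex n)) (e f : edge n).

(** For a forest E and edges of its closure, this says that the increasing path of E below f runs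
    through e. *)
Definition covers E F : Prop :=
  forall e, e \in E -> exists2 f, f \in F & reach E f.1 e.1 /\ reach E e.2 f.2.

Lemma reach_edge V E a b : graph_on V E -> (a, b) \in E -> reach E a b.
Proof.
move=> gE abE; apply: connect1; have [ab _ _] := gE _ abE.
by rewrite /up /= abE andbT.
Qed.

Section Shape.
Variables (E F : {set edge n}) (x : vertex n) (s : seq (vertex n)).
Hypotheses (gE : graph_on setT E) (nE : noncrossing E).
Hypotheses (shape : pseudo_comp_shape setT E x s) (lt_ends : x < last x s).
Let y := last x s.

Lemma shape_reach : reach E x y.
Proof. by have [_] := up_path_reach (shape_up shape) (mem_head x s). Qed.

(** If a is on the path, this is [shape_inner]; if not, (a, b) would cross the edge by which the
    path passes over a. *)
Lemma shape_no_exit_right a b : (a, b) \in E -> x < a -> a < y -> b <= y.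
Proof.
move=> abE xa ay; rewrite leqNgt; apply/negP => yb.
have [axs|axs] := boolP (a \in x :: s).
  have [] := shape_inner shape axs xa ay abE; first by rewrite eqxx.
  by move=> _; rewrite leqNgt yb.
have [|c [d [/andP[_ cdE] ca ad _ ds]]] := path_cross (shape_up shape) xa ay.
  by apply: contra axs => as_; rewrite inE as_ orbT.
have [_ /reach_leq dy] := up_path_reach (shape_up shape) ds.
by case: (nE ca ad (leq_ltn_trans dy yb)).
Qed.

Lemma shape_no_exit_left a b : (a, b) \in E -> x < b -> b < y -> x <= a.
Proof.
move=> abE xb b_y; rewrite leqNgt; apply/negP => ax.
have [bxs|bxs] := boolP (b \in x :: s).
  have [] := shape_inner shape bxs xb b_y abE; first by rewrite eqxx orbT.
  by rewrite leqNgt ax.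
have [|c [d [/andP[_ cdE] cb bd cs _]]] := path_cross (shape_up shape) xb b_y.
  by apply: contra bxs => bs; rewrite inE bs orbT.
have [/reach_leq xc _] := up_path_reach (shape_up shape) cs.
by case: (nE (leq_trans ax xc) cb bd).
Qed.

Section Conditions.
Hypotheses (gF : graph_on setT F) (aF : alternating F) (nF : noncrossing F).
Hypothesis covEF : covers E F.

(** Let i be the least left end of an edge of F ending at y, or y itself if there is none. If x < i,
    an edge of E over the gap just below i is covered by some (u, w) in F with u < i <= w, and w <=
    y since no increasing path gets past y. Now w = y contradicts the choice of i, w = i < y
    alternation, and i < w < y noncrossing. *)
Lemma covers_right : (forall u, y < u -> (y, u) \notin E) ->
  exists2 i : vertex n, i <= x & (i, y) \in F.
Proof.
move=> no_right; pose P (u : vertex n) := (u == y) || ((u, y) \in F).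
have Py : P y by rewrite /P eqxx.
have [i Pi i_min] := arg_minnP (fun u => u : nat) Py.
have [ix|xi] := leqP i x.
  exists i => //; case/orP: Pi => // /eqP iy.
  by rewrite iy leqNgt lt_ends in ix.
have iy : i <= y.
  by case/orP: Pi => [/eqP->//|/gF[/= /ltnW]].
have [||a [b [abE ai ib xa b_y]]] := reach_cut (z := i.-1) shape_reach; [lia..|].
have {}ai : a < i by lia.
have {}ib : i <= b by lia.
have [[u w] uwF /= [/reach_leq ua bw]] := covEF abE; have /reach_leq le_bw := bw.
have [le_wy|lt_yw] := leqP w y; last first.
  have [c [d [cdE cy yd /reach_leq bc _]]] := reach_cut bw (reach_leq b_y) lt_yw.
  move: cy; rewrite leq_eqVlt => /orP[/eqP/val_inj cy|cy].
    by rewrite cy (negPf (no_right _ yd)) in cdE.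
  have := shape_no_exit_right cdE (leq_trans xi (leq_trans ib bc)) cy.
  by rewrite leqNgt yd.
have ui : u < i by apply: leq_ltn_trans ua ai.
have iw := leq_trans ib le_bw.
move: le_wy; rewrite leq_eqVlt => /orP[/eqP/val_inj wy|lt_wy].
  by have := i_min u; rewrite /P -wy uwF orbT leqNgt ui => /(_ isT).
have iyF : (i, y) \in F.
  by case/orP: Pi => // /eqP i_y; rewrite i_y leqNgt lt_wy in iw.
have lt_iy := leq_ltn_trans iw lt_wy.
move: iw; rewrite leq_eqVlt => /orP[/eqP/val_inj i_w|iw].
  by case: (aF ui lt_iy); split=> //; rewrite i_w.
by case: (nF ui iw lt_wy).
Qed.

(** Mirror image of [covers_right], with j the greatest right end of an edge of F starting at x. *)
Lemma covers_left : (forall u, u < x -> (u, x) \notin E) ->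
  exists2 j : vertex n, y <= j & (x, j) \in F.
Proof.
move=> no_left; pose P (u : vertex n) := (u == x) || ((x, u) \in F).
have Px : P x by rewrite /P eqxx.
have [j Pj j_max] := arg_maxnP (fun u => u : nat) Px.
have [yj|jy] := leqP y j.
  exists j => //; case/orP: Pj => // /eqP jx.
  by rewrite jx leqNgt lt_ends in yj.
have xj : x <= j.
  by case/orP: Pj => [/eqP->//|/gF[/= /ltnW]].
have [a [b [abE aj jb xa _]]] := reach_cut shape_reach xj jy.
have [[u w] uwF /= [ua /reach_leq bw]] := covEF abE; have /reach_leq le_ua := ua.
have jw := leq_trans jb bw; have uj := leq_trans le_ua aj.
have [le_xu|lt_ux] := leqP x u; last first.
  have /reach_leq le_xa := xa.
  have [||c [d [cdE cx xd _ /reach_leq da]]] := reach_cut (z := x.-1) ua; [lia..|].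
  have {}cx : c < x by lia.
  have {xd} : x <= d by lia.
  rewrite leq_eqVlt => /orP[/eqP/val_inj xd|xd].
    by move: cdE; rewrite -xd (negPf (no_left _ cx)).
  have := shape_no_exit_left cdE xd (leq_ltn_trans da (leq_ltn_trans aj jy)).
  by rewrite leqNgt cx.
move: le_xu; rewrite leq_eqVlt => /orP[/eqP/val_inj xu|lt_xu].
  have Pw : P w by rewrite /P xu uwF orbT.
  have : w <= j := j_max w Pw.
  by rewrite leqNgt jw.
have xjF : (x, j) \in F.
  by case/orP: Pj => // /eqP j_x; rewrite j_x leqNgt lt_xu in uj.
have lt_xj := leq_trans lt_xu uj.
move: uj; rewrite leq_eqVlt => /orP[/eqP/val_inj uj|uj].
  by case: (aF lt_xj jw); split=> //; rewrite -uj.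
by case: (nF lt_xu uj jw).
Qed.

End Conditions.

(** An increasing path from i to y that missed x would jump over x by an edge (a, b): b = y is
    excluded by the hypothesis at y, and b < y by [shape_no_exit_left]. *)
Lemma reach_through_left (i : vertex n) : i <= x -> reach E i y ->
  edges_within E y x y -> reach E i x.
Proof.
have xy : x < y := lt_ends.
move=> ix iy wy; move: ix; rewrite leq_eqVlt => /orP[/eqP/val_inj->|ix].
  exact: connect0.
have [||a [b [abE ax xb ia b_y]]] := reach_cut (z := x.-1) iy; [by lia.. |].
have {}ax : a < x by lia.
have {xb} : x <= b by lia.
rewrite leq_eqVlt => /orP[/eqP/val_inj xb|xb].
  by rewrite xb; apply: connect_trans ia (reach_edge gE abE).
have := reach_leq b_y; rewrite leq_eqVlt => /orP[/eqP/val_inj by_|by_].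
  have [] := wy _ abE; first by rewrite /= by_ eqxx orbT.
  by rewrite leqNgt ax.
by have := shape_no_exit_left abE xb by_; rewrite leqNgt ax.
Qed.

Lemma reach_through_right (j : vertex n) : y <= j -> reach E x j ->
  edges_within E x x y -> reach E y j.
Proof.
move=> yj xj wx; move: yj; rewrite leq_eqVlt => /orP[/eqP/val_inj->|yj].
  exact: connect0.
have [a [b [abE ay yb xa bj]]] := reach_cut xj (ltnW lt_ends) yj.
move: ay; rewrite leq_eqVlt => /orP[/eqP/val_inj ay|ay].
  by rewrite /y -ay; apply: connect_trans (reach_edge gE abE) bj.
have := reach_leq xa; rewrite leq_eqVlt => /orP[/eqP/val_inj xa_|xa_].
  have [] := wx _ abE; first by rewrite /= xa_ eqxx.
  by move=> _; rewrite leqNgt yb.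
by have := shape_no_exit_right abE xa_ ay; rewrite leqNgt yb.
Qed.

End Shape.

Lemma pseudo_comp_lt V E x s : pseudo_comp V E x s -> s != [::] -> x < last x s.
Proof.
elim=> {V E x s} [V E x s [_ us [xV sx] [lV _]] s0|//].
rewrite ltn_neqAle sx // andbT val_eqE; case: s us s0 {lV} => //= y s /andP[xs _] _.
by apply: contraNneq xs => ->; apply: mem_last.
Qed.

(** Let e lie on a pseudo-component from x to y. If an edge of E enters x from the left, no edge at
    y leaves [x, y]; so the component is a right one, and the path below the edge (i, y) of F runs
    through x and then e. The case of an edge leaving y to the right is symmetric. *)
Lemma admissible_covers E F : tree_on setT E -> noncrossing E ->
  admissible E F -> covers E F.
Proof.
move=> tE nE admF e eE; have [_ [gE acE] _] := tE.
have [x [s [pc exs]]] := pseudo_comp_cover tE eE.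
have lt_ends : x < last x s.
  by apply: pseudo_comp_lt pc _; apply: contraTneq exs => ->; rewrite inE.
have shape := pseudo_compP pc tE nE lt_ends.
have [_ xe el] := path_edges_up (shape_up shape) exs.
have pco : pseudo_comp_on E x (last x s) by split=> //; exists s.
have closed f : f \in F -> reach E f.1 f.2.
  by case/(adm_closure admF)/in_closureP.
have [[u ux uE]|no_left] := pselect (exists2 u : vertex n, u < x & (u, x) \in E).
  have wl : edges_within E (last x s) x (last x s).
    case: (shape_ends shape) => [[[_ sx] _]|[_ wx]|[]//].
      by have := sx u (in_setT _); rewrite leqNgt ux.
    by have [] := wx _ uE; rewrite /= ?eqxx ?orbT // leqNgt ux.
  have [|i ix iF] := adm_right admF (i := x) (j := last x s).
    split=> // v lv; apply/negP => lvE.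
    by have [] := wl _ lvE; rewrite /= ?eqxx // => _; rewrite leqNgt lv.
  exists (i, last x s) => //=; split=> //; apply: connect_trans xe.
  exact: reach_through_left ix (closed _ iF) wl.
have left_pc : left_pseudo_comp_on E x (last x s).
  by split=> // u ux; apply/negP => uE; apply: no_left; exists u.
have [j lj jF] := adm_left admF left_pc.
have [[u lu uE]|no_right] :=
    pselect (exists2 u : vertex n, last x s < u & (last x s, u) \in E).
  have wx : edges_within E x x (last x s).
    case: (shape_ends shape) => [[_ [_ ll]]|[]//|[_ wl]].
      by have := ll u (in_setT _); rewrite leqNgt lu.
    by have [] := wl _ uE; rewrite /= ?eqxx // => _; rewrite leqNgt lu.
  exists (x, j) => //=; split=> //; apply: connect_trans el _.
  exact: reach_through_right lj (closed _ jF) wx.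
(* The component is now both left and right; (i, y) and (x, j) would cross unless i = x or j = y, so
   (x, y) itself is in F. *)
have [|i ix iF] := adm_right admF (i := x) (j := last x s).
  by split=> // u lu; apply/negP => uE; apply: no_right; exists u.
suff xlF : (x, last x s) \in F by exists (x, last x s).
move: ix; rewrite leq_eqVlt => /orP[/eqP/val_inj ix|ix]; first by rewrite -{1}ix.
move: lj; rewrite leq_eqVlt => /orP[/eqP/val_inj lj|lj]; first by rewrite lj.
by case: (adm_noncrossing admF ix lt_ends lj).
Qed.

(** The edge (1, n+1) is the right condition for the path P of the whole tree, whose least possible
    left end is 1. *)
Lemma covers_admissible E F : 0 < n -> tree_on setT E -> noncrossing E ->
  graph_on setT F -> (forall f, f \in F -> reach E f.1 f.2) ->
  alternating F -> noncrossing F -> covers E F -> admissible E F.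
Proof.
move=> n0 tE nE gF clF aF nF cF; have [_ [gE acE] _] := tE.
have right x y : right_pseudo_comp_on E x y ->
    exists2 i : vertex n, i <= x & (i, y) \in F.
  case=> [[xy [s pc ls]] no_right]; subst y.
  have shape := pseudo_compP pc tE nE xy.
  exact: (covers_right nE shape xy gF aF nF cF no_right).
split=> //.
- split=> //; exact: alternating_noncrossing_acyclic gF aF nF.
- by move=> f fF; apply/in_closureP; have [lt_f _ _] := gF _ fF; split; auto.
- have [x [s mmp]] := min_max_path_exists tE.
  have [_ _ [_ sx] [_ lx]] := mmp.
  have x0 : x = ord0 by apply/val_inj/eqP; have := sx ord0 (in_setT _); rewrite leqn0.
  have l0 : last x s = ord_max.
    by apply/val_inj/eqP; rewrite eqn_leq leq_ord; apply: (lx ord_max (in_setT _)).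
  have [|i] := right ord0 ord_max.
    split; last by move=> u; rewrite ltnNge leq_ord.
    split=> //; exists s; last by rewrite -x0.
    by rewrite -x0; apply: PseudoPath.
  by rewrite leqn0 => /eqP i0; have -> : i = ord0 by apply: val_inj.
- move=> x y [[xy [s pc ls]] no_left]; subst y.
  have shape := pseudo_compP pc tE nE xy.
  exact: (covers_left nE shape xy gF aF nF cF no_left).
Qed.

End Covering.

(** * Reduced forms *)

Section ReducedForms.

Variable n : nat.
Implicit Types (e f : edge n) (w m : seq (edge n)) (E F : {set edge n}).
Implicit Types (p q r : ncpoly n) (t : nat * seq (edge n)).
Local Notation swaps := (clos_refl_trans _ (@swap n)).

(** The ideal has no closure clause for scalars; they are absorbed into the left factor of a
    generator. *)
Lemma comm_idealZ (k : {poly int}) p : comm_ideal p -> comm_ideal (k *: p)%R.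
Proof.
elim=> [|a b _ IHa _ IHb|a b e f d].
- by rewrite scaler0; apply: CommIdeal0.
- by rewrite scalerDr; apply: CommIdealD.
- by rewrite -!mulrA scalerAl !mulrA; apply: CommIdealM.
Qed.

Lemma eq_upto_comm_refl p : eq_upto_comm p p.
Proof. by rewrite /eq_upto_comm subrr; apply: CommIdeal0. Qed.

Lemma eq_upto_comm_trans p q r :
  eq_upto_comm p q -> eq_upto_comm q r -> eq_upto_comm p r.
Proof. by move=> pq /(CommIdealD pq); rewrite addrA subrK. Qed.

Lemma eq_upto_commD p q p' q' :
  eq_upto_comm p p' -> eq_upto_comm q q' -> eq_upto_comm (p + q)%R (p' + q')%R.
Proof. by move=> pp' qq'; rewrite /eq_upto_comm opprD addrACA; apply: CommIdealD. Qed.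

Lemma eq_upto_commZ (k : {poly int}) p q :
  eq_upto_comm p q -> eq_upto_comm (k *: p)%R (k *: q)%R.
Proof. by move=> /(comm_idealZ k); rewrite scalerBr. Qed.

Lemma eq_upto_comm_sum (A : eqType) (l : seq A) (f g : A -> ncpoly n) :
  (forall a, a \in l -> eq_upto_comm (f a) (g a)) ->
  eq_upto_comm (\sum_(a <- l) f a)%R (\sum_(a <- l) g a)%R.
Proof.
elim: l => [|a l IHl] fg; first by rewrite !big_nil; apply: eq_upto_comm_refl.
rewrite !big_cons; apply: eq_upto_commD; first by apply: fg; rewrite mem_head.
by apply: IHl => b bl; apply: fg; rewrite inE bl orbT.
Qed.

Lemma swaps_ncmon w w' : swaps w w' -> eq_upto_comm (ncmon w) (ncmon w').
Proof.
elim=> [_ _ [m1 m2 e f d]|a|a b c _ ab _ bc].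
- rewrite /eq_upto_comm /ncmon !big_cat !big_cons !big_nil /= !mulr1.
  by rewrite -mulrBr -mulrBl mulrA; apply: CommIdealM.
- exact: eq_upto_comm_refl.
- exact: eq_upto_comm_trans ab bc.
Qed.

Lemma good_forest_word w : good_forest w -> good_word w.
Proof.
case=> uw [gw _] middle left right nw; apply/andP; split.
  by apply/allP => e ew; have [] := gw e; rewrite ?inE.
apply/(pairwiseP (ord0, ord0)) => a b al bl ab.
rewrite !inE in al bl.
set e := nth _ w a; set f := nth _ w b.
have [ie jf] : index e w = a /\ index f w = b by rewrite !index_uniq.
have [ew fw] : e \in w /\ f \in w by rewrite !mem_nth.
have lt_e : e.1 < e.2 by have [] := gw e; rewrite ?inE.
have lt_f : f.1 < f.2 by have [] := gw f; rewrite ?inE.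
have neq_ef : e != f by apply: contraTneq ab => ef; rewrite -ie ef jf ltnn.
move: ie jf ew fw lt_e lt_f neq_ef; case: e f => [e1 e2] [f1 f2] /= ie jf ew fw.
move=> lt_e lt_f neq_ef; rewrite /precedes /= lt_e lt_f /=.
apply/and5P; split.
- apply/eqP => /val_inj ef; subst e1; have := middle _ _ _ lt_f lt_e fw ew.
  by rewrite ie jf; lia.
- apply/implyP => /eqP/val_inj ef; subst e1; rewrite ltnNge leq_eqVlt.
  apply/negP => /orP[/eqP/val_inj ef|ef]; first by rewrite ef eqxx in neq_ef.
  by have := left _ _ _ lt_e ef ew fw; rewrite ie jf; lia.
- apply/implyP => /eqP/val_inj ef; subst e2; rewrite ltnNge leq_eqVlt.
  apply/negP => /orP[/eqP/val_inj ef|ef]; first by rewrite ef eqxx in neq_ef.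
  by have := right _ _ _ ef lt_f ew fw; rewrite ie jf; lia.
- by apply/negP => /and3P[ef fe ee]; case: (nw _ _ _ _ ef fe ee); rewrite !inE.
- by apply/negP => /and3P[ef fe ee]; case: (nw _ _ _ _ ef fe ee); rewrite !inE.
Qed.

Lemma asbool_open_cone_perm w w' v :
  perm_eq w w' -> `[< open_cone w v >] = `[< open_cone w' v >].
Proof.
move=> ww'; apply: asbool_equiv_eq; split; apply: open_cone_perm => //.
by rewrite perm_sym.
Qed.

Section Invariant.
Variables (E : {set edge n}) (N : nat).
Hypothesis gE : graph_on setT E.

(** Applied with E the edge set of T and N = n. A merge trades one letter for one factor beta, so
    [term_degree] yields the exponent; [term_reach] and [term_covers] give admissibility of
    irreducible terms. *)
Record good_term t : Prop := GoodTerm {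
  term_good : good_word t.2;
  term_indep : indep t.2;
  term_degree : t.1 + size t.2 = N;
  term_reach : forall f, f \in t.2 -> reach E f.1 f.2;
  term_covers : covers E [set:: t.2]
}.

Lemma good_term_swap a w w' : swap w w' -> good_term (a, w) -> good_term (a, w').
Proof.
move=> sw [/= gw iw dw rw cw]; have pw := swap_perm sw; split=> /=.
- exact: swap_good sw gw.
- exact: indep_perm pw iw.
- by rewrite -(perm_size pw).
- by move=> f; rewrite -(perm_mem pw); apply: rw.
- move=> e /cw[f fw ef]; exists f => //; by move: fw; rewrite !inE (perm_mem pw).
Qed.

Section Reduction.
Variables (a : nat) (m1 m2 : seq (edge n)) (i j k : vertex n).
Hypotheses (lt_ij : i < j) (lt_jk : j < k).
Hypothesis good_w : good_term (a, m1 ++ [:: (i, j); (j, k)] ++ m2).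

Let w_perm l : perm_eq (m1 ++ l ++ m2) (l ++ (m1 ++ m2)).
Proof. by rewrite perm_catCA. Qed.

Let uniq_perm_of l : good_word (m1 ++ l ++ m2) -> uniq (l ++ (m1 ++ m2)).
Proof. by move/good_word_uniq; rewrite (perm_uniq (w_perm l)). Qed.

Let gw := term_good good_w.
Let uniq_w := uniq_perm_of gw.
Let uniq_left := uniq_perm_of (good_reduce_left lt_ij lt_jk gw).
Let uniq_right := uniq_perm_of (good_reduce_right lt_ij lt_jk gw).
Let indep_w := indep_perm (w_perm [:: (i, j); (j, k)]) (term_indep good_w).

(** All three results of a reduction contain (i, k), and the path below it contains those below (i,
    j) and (j, k). *)
Let w_covers l : (i, k) \in l -> covers E [set:: m1 ++ l ++ m2].
Proof.
move=> ikl e /(term_covers good_w)[f]; rewrite inE /= !mem_cat !inE.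
have rij : reach E i j.
  by apply: (term_reach good_w (f := (i, j))); rewrite /= !mem_cat !inE eqxx ?orbT.
have rjk : reach E j k.
  by apply: (term_reach good_w (f := (j, k))); rewrite /= !mem_cat !inE eqxx ?orbT.
case/or4P=> [fm|/eqP->|/eqP->|fm] [fe ef].
- by exists f; rewrite // inE !mem_cat fm.
- exists (i, k); first by rewrite inE !mem_cat ikl orbT.
  by split=> //; apply: connect_trans ef rjk.
- exists (i, k); first by rewrite inE !mem_cat ikl orbT.
  by split=> //; apply: connect_trans rij fe.
- by exists f; rewrite // inE !mem_cat fm !orbT.
Qed.

Let w_reach l : {subset l <= [:: (i, k); (i, j); (j, k)]} ->
  forall f, f \in m1 ++ l ++ m2 -> reach E f.1 f.2.
Proof.
move=> sub f; have rw g : g \in [:: (i, j); (j, k)] ++ m1 ++ m2 -> reach E g.1 g.2.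
  by rewrite -(perm_mem (w_perm _)); apply: (term_reach good_w).
rewrite (perm_mem (w_perm _)) mem_cat => /orP[/sub|fm]; last first.
  by apply: rw; rewrite mem_cat fm orbT.
rewrite inE => /predU1P[->|fl]; last by apply: rw; rewrite mem_cat fl.
apply: (@connect_trans _ _ j); first by apply: (rw (i, j)); rewrite inE eqxx.
by apply: (rw (j, k)); rewrite !inE eqxx orbT.
Qed.

Let degree : a + (size m1 + size m2).+2 = N.
Proof. by have := term_degree good_w; rewrite /= !size_cat /=; lia. Qed.

Lemma good_term_left : good_term (a, m1 ++ [:: (i, k); (i, j)] ++ m2).
Proof.
split=> /=.
- exact: good_reduce_left gw.
- apply: (@indep_perm _ ([:: (i, k); (i, j)] ++ m1 ++ m2)).
    by rewrite perm_sym; apply: (w_perm [:: _; _]).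
  exact: (indep_reduce_left uniq_w indep_w).
- by rewrite size_cat /= -degree; lia.
- by apply: (w_reach (l := [:: (i, k); (i, j)])) => f; rewrite !inE orbA => ->.
- by apply: (w_covers (l := [:: (i, k); (i, j)])); rewrite inE eqxx.
Qed.

Lemma good_term_right : good_term (a, m1 ++ [:: (j, k); (i, k)] ++ m2).
Proof.
split=> /=.
- exact: good_reduce_right gw.
- apply: (@indep_perm _ ([:: (j, k); (i, k)] ++ m1 ++ m2)).
    by rewrite perm_sym; apply: (w_perm [:: _; _]).
  exact: (indep_reduce_right uniq_w indep_w).
- by rewrite size_cat /= -degree; lia.
- by apply: (w_reach (l := [:: (j, k); (i, k)])) => f; rewrite !inE => /orP[]->; rewrite ?orbT.
- by apply: (w_covers (l := [:: (j, k); (i, k)])); rewrite !inE eqxx orbT.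
Qed.

Lemma good_term_merge : good_term (a.+1, m1 ++ [:: (i, k)] ++ m2).
Proof.
split=> /=.
- exact: good_reduce_merge gw.
- apply: (@indep_perm _ ([:: (i, k)] ++ m1 ++ m2)).
    by rewrite perm_sym; apply: (w_perm [:: _]).
  exact: (indep_reduce_merge uniq_w indep_w).
- by rewrite size_cat /= -degree; lia.
- by apply: (w_reach (l := [:: (i, k)])) => f; rewrite !inE => ->.
- by apply: (w_covers (l := [:: (i, k)])); rewrite inE eqxx.
Qed.

Lemma open_cone_split v :
  `[< open_cone (m1 ++ [:: (i, j); (j, k)] ++ m2) v >] =
  (`[< open_cone (m1 ++ [:: (i, k); (i, j)] ++ m2) v >] +
   `[< open_cone (m1 ++ [:: (j, k); (i, k)] ++ m2) v >] +
   `[< open_cone (m1 ++ [:: (i, k)] ++ m2) v >])%N :> nat.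
Proof.
rewrite !(asbool_open_cone_perm _ (w_perm _)).
exact: (open_cone_reduce uniq_w uniq_left uniq_right indep_w).
Qed.

End Reduction.

Definition cone_count v (s : seq (nat * seq (edge n))) : nat :=
  count (fun t => `[< open_cone t.2 v >]) s.

Lemma step_invariant s s' : step s s' -> (forall t, t \in s -> good_term t) ->
  (forall t, t \in s' -> good_term t) /\ forall v, cone_count v s' = cone_count v s.
Proof.
case=> [s1 s2 a w w' sw|s1 s2 a m1 m2 i j k lt_ij lt_jk] good_s.
  have good_w : good_term (a, w) by apply: good_s; rewrite !mem_cat inE eqxx orbT.
  split=> [t|v].
    rewrite !mem_cat inE => /or3P[ts|/eqP->|ts].
    - by apply: good_s; rewrite mem_cat ts.
    - exact: good_term_swap sw good_w.
    - by apply: good_s; rewrite !mem_cat ts !orbT.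
  by rewrite /cone_count !count_cat /= (asbool_open_cone_perm v (swap_perm sw)).
have good_w : good_term (a, m1 ++ [:: (i, j); (j, k)] ++ m2).
  by apply: good_s; rewrite !mem_cat inE eqxx orbT.
split=> [t|v]; last first.
  have /= split_w := open_cone_split lt_ij lt_jk good_w v.
  by rewrite /cone_count !count_cat /= split_w !addnA.
rewrite !mem_cat !inE -!orbA => /or4P[ts|/eqP->|/eqP->|/orP[/eqP->|ts]].
- by apply: good_s; rewrite mem_cat ts.
- exact: (good_term_left lt_ij lt_jk good_w).
- exact: (good_term_right lt_ij lt_jk good_w).
- exact: (good_term_merge lt_ij lt_jk good_w).
- by apply: good_s; rewrite !mem_cat ts !orbT.
Qed.

End Invariant.

(** Each vector of F is a nonnegative combination along its path. For a single e, splitting the path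
    below a covering f at e makes the coefficient of e positive; by independence the combinations
    for all e have the same coefficients on [w]. *)
Lemma covers_open_cone w F : uniq w -> indep w ->
  (forall f, f \in F -> reach [set:: w] f.1 f.2) -> covers [set:: w] F ->
  open_cone w (\sum_(f in F) root_vec f)%R.
Proof.
move=> uw iw clF cF.
pose nonneg v := exists2 c : edge n -> rat, (forall e, 0 <= c e)%R & flow c w = v.
have nonnegD v v' : nonneg v -> nonneg v' -> nonneg (v + v')%R.
  move=> [c c0 <-] [c' c0' <-]; exists (fun e => c e + c' e)%R; last exact: flowD.
  by move=> e; apply: addr_ge0.
have nonneg0 : nonneg 0%R.
  exists (fun=> 0%R) => //; rewrite /flow big1 // => e _; exact: scale0r.
pose delta e f : rat := (e == f)%:R%R.
have flow_delta e : e \in w -> flow (delta e) w = root_vec e.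
  move=> ew; rewrite /flow (bigD1_seq e) //= /delta eqxx scale1r big1 ?addr0 //.
  by move=> f /negPf; rewrite eq_sym => ->; rewrite scale0r.
have root_vecxx u : root_vec (u, u) = 0%R :> 'rV[rat]_n.+1 by rewrite /root_vec subrr.
have nonneg_reach u v : reach [set:: w] u v -> nonneg (root_vec (u, v)).
  case/connectP=> p; elim: p u => [|z p IHp] u /=.
    by move=> _ ->; rewrite root_vecxx.
  case/andP=> /andP[_ uz] pp def_v; rewrite (root_vec_trans u z v).
  apply: nonnegD; last exact: IHp.
  exists (delta (u, z)) => [e|]; first by rewrite ler0n.
  by apply: flow_delta; move: uz; rewrite inE.
have nonneg_root f : f \in F -> nonneg (root_vec f).
  by move=> /clF/nonneg_reach; rewrite -surjective_pairing.
have nonneg_sum (Q : pred (edge n)) : nonneg (\sum_(f in F | Q f) root_vec f)%R.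
  by apply: (big_ind nonneg) => // f /andP[/nonneg_root].
have pos e : e \in w -> exists c, [/\ forall f, (0 <= c f)%R, (0 < c e)%R
    & flow c w = (\sum_(f in F) root_vec f)%R].
  move=> ew; have [|f fF [fe ef]] := cF e; first by rewrite inE.
  have [c1 c1_0 c1E] := nonneg_reach _ _ fe.
  have [c2 c2_0 c2E] := nonneg_reach _ _ ef.
  have [c3 c3_0 c3E] := nonneg_sum (fun g => g != f).
  exists (fun g => delta e g + c1 g + c2 g + c3 g)%R; split.
  - by move=> g; rewrite !addr_ge0 // ler0n.
  - by rewrite /delta eqxx -!addrA ltr_wpDr ?ltr01 // !addr_ge0.
  rewrite !flowD flow_delta // c1E c2E c3E [RHS](bigD1 f) //=; congr (_ + _)%R.
  have -> : root_vec e = root_vec (e.1, e.2) by rewrite -surjective_pairing.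
  by rewrite [X in (X + _)%R]addrC -!root_vec_trans -surjective_pairing.
have [c c0 cE] := nonneg_sum predT.
have {}cE : flow c w = (\sum_(f in F) root_vec f)%R.
  by rewrite cE; apply: eq_bigl => f; rewrite andbT.
exists c => // e ew; have [c' [_ c'e c'E]] := pos e ew.
by rewrite (indep_inj iw (etrans cE (esym c'E)) ew).
Qed.

(** The sum is the flow of F with all coefficients 1, so [alternating_noncrossing_unique] compares
    two positively weighted graphs of equal excess. *)
Lemma open_cone_alternating w F : uniq w -> graph_on setT [set:: w] ->
  alternating [set:: w] -> noncrossing [set:: w] ->
  graph_on setT F -> alternating F -> noncrossing F ->
  `[< open_cone w (\sum_(f in F) root_vec f)%R >] = ([set:: w] == F).
Proof.
move=> uw gw aw nw gF aF nF.
have sumF : (\sum_(f in F) root_vec f = flow (fun=> 1) (enum F))%R.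
  by rewrite /flow big_enum; apply: eq_bigr => f _; rewrite scale1r.
apply: (asbool_equiv_eqP eqP); split=> [[c c0 cE]|<-]; last first.
  exists (fun=> 1%R) => // ; rewrite /flow big_uniq //=; apply: eq_big => [f|f _].
    by rewrite inE.
  exact: scale1r.
apply: (@alternating_noncrossing_unique _ _ _ c (fun=> 1%R)) => //.
  by move=> e; rewrite inE; apply: c0.
move=> u; rewrite -flow_coord // cE sumF flow_coord ?enum_uniq //.
by congr excess; apply/setP => f; rewrite inE mem_enum.
Qed.

End ReducedForms.

(** * Multiplicities of the terms of a reduced form *)

Lemma good_tree_term (n : nat) (T : seq (edge n)) :
  good_tree T -> good_term [set:: T] n (0, T).
Proof.
case=> gT [_ [gE acE] cE]; have uT := good_uniq gT.
have iT := acyclic_indep uT gE acE.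
split=> //=.
- exact: good_forest_word.
- by apply: tree_size => // u v; apply: cE; rewrite inE.
- by move=> [a b] fT; apply: (reach_edge gE); rewrite inE.
- by move=> e eT; exists e => //; split; apply: connect0.
Qed.

Lemma reachable_invariant (n : nat) (E : {set edge n}) N s s' :
  clos_refl_trans _ (@step n) s s' -> (forall t, t \in s -> good_term E N t) ->
  (forall t, t \in s' -> good_term E N t) /\
  forall v, cone_count v s' = cone_count v s.
Proof.
elim=> [s1 s2|s1|s1 s2 s3 _ IH12 _ IH23] good_s //; first exact: step_invariant.
have [good_s2 c12] := IH12 good_s; have [good_s3 c23] := IH23 good_s2.
by split=> // v; rewrite c23.
Qed.

Theorem theorem2 (n : nat) (n_gt0 : 0 < n) (T : seq (edge n)) (P : ncpoly n)
  (T_good : good_tree T) (P_reduced : reduced_form T P) :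
  eq_upto_comm P
    (\sum_(F : {set edge n} | `[< admissible [set:: T] F >])
       'X ^+ (n - #|F|) *: ncmon (lex_labeled F))%R.
Proof.
have good0 := good_tree_term T_good; have [gT tT] := T_good.
have [_ [gE acE] _] := tT; have nE := good_noncrossing gT.
have [s [steps irr P_s]] := P_reduced.
have [good_s count_s] : (forall t, t \in s -> good_term [set:: T] n t) /\
    forall v, cone_count v s = cone_count v [:: (0, T)].
  by apply: reachable_invariant steps _ => t; rewrite inE => /eqP->.
pose supp (t : nat * seq (edge n)) := [set:: t.2].
have supp_ok t : t \in s -> [/\ graph_on setT (supp t), alternating (supp t),
    noncrossing (supp t) & admissible [set:: T] (supp t)].
  move=> ts; have [gw iw dw rw cw] := good_s t ts; have irr_t := irr t ts.
  have gt := good_word_oriented gw; have nt := good_word_noncrossing gw.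
  have at_ := irreducible_alternating gw irr_t.
  split=> //; apply: covers_admissible => // f; rewrite inE; exact: rw.
apply: eq_upto_comm_trans P_s _.
pose G (F : {set edge n}) : ncpoly n := ('X ^+ (n - #|F|) *: ncmon (lex_labeled F))%R.
(* Each term is commuted into lexicographic order, after which it depends only on its support. *)
apply: (@eq_upto_comm_trans _ _ (\sum_(t <- s) G (supp t))%R).
  apply: eq_upto_comm_sum => t ts; have [gw _ dw _ _] := good_s t ts.
  have [_ at_ _ _] := supp_ok t ts; rewrite /G.
  have -> : #|supp t| = size t.2.
    by rewrite -(card_uniqP (good_word_uniq gw)); apply: eq_card => f; rewrite inE.
  have -> : n - size t.2 = t.1 := esym (canRL (addnK _) dw).
  apply: eq_upto_commZ; apply: swaps_ncmon.
  exact: swaps_lex_labeled.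
suff perm_s : perm_eq [seq supp t | t <- s]
    [seq F <- index_enum {set edge n} | `[< admissible [set:: T] F >]].
  rewrite -(big_map supp predT G) (perm_big _ perm_s) big_filter.
  exact: eq_upto_comm_refl.
(* Every admissible F is the support of exactly one term. *)
have mem_count F : count_mem F [seq supp t | t <- s] = `[< admissible [set:: T] F >].
  case: asboolP => [adm|nadm]; last first.
    apply/count_memPn/mapP => -[t ts F_t]; apply: nadm; rewrite F_t.
    by have [] := supp_ok t ts.
  have [gF _] := adm_forest adm.
  (* The initial term T contributes 1 at this vector; among the final terms, exactly those with
     support F contribute. *)
  have := count_s (\sum_(f in F) root_vec f)%R.
  rewrite /cone_count /= asboolT ?addn0; last first.
    have [_ iT _ _ _] := good0; apply: covers_open_cone => //.
    - exact: good_uniq gT.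
    - by move=> f /(adm_closure adm)/in_closureP[].
    - exact: admissible_covers.
  move=> count1; apply: etrans count1; rewrite count_map; apply: eq_in_count => t ts /=.
  have [gt at_ nt _] := supp_ok t ts; have [gw _ _ _ _] := good_s t ts.
  rewrite open_cone_alternating //; first exact: good_word_uniq.
    exact: adm_alternating adm.
  exact: adm_noncrossing adm.
apply: uniq_perm.
- apply/count_mem_uniq => F; rewrite mem_count -has_pred1 has_count mem_count.
  by case: asbool.
- exact/filter_uniq/index_enum_uniq.
move=> F; rewrite mem_filter mem_index_enum andbT -has_pred1 has_count mem_count.
by case: asbool.
Qed.
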